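(* Let $X$ be a Peano continuum, $y_0\in X$, $\{x_j\}_{j\in\mathbb{N}}$ a sequence in $X$, $(A_j,a_j)$ ($j\in\mathbb{N}$) based spaces, and $Y=\operatorname{\bf Adj}(X,x_j,A_j,a_j)$. Then for all $n\geq 2$, the canonical homomorphism \[\Psi:\pi_n(Y,y_0)\to \pi_n(X,y_0)\oplus\prod_{j\in\mathbb{N}}\pi_n(A_j,a_j),\qquad \Psi([f])=([r\circ f],[r_1\circ f],[r_2\circ f],\dots)\] is a split epimorphism.
   Context: All spaces Hausdorff; Peano continuum = connected, locally path-connected compact metric space. $\operatorname{\bf Adj}(X,x_j,A_j,a_j)$: $Y_k$ is the adjunction space obtained from $X\sqcup A_1\sqcup\dots\sqcup A_k$ by identifying $a_j\sim x_j$ ($j\le k$), $\rho_{k+1,k}:Y_{k+1}\to Y_k$ collapses $A_{k+1}$ to $x_{k+1}$, and the space is $\varprojlim_k Y_k$ with subspace topology in $\prod_kY_k$; its underlying set is $(X\sqcup\coprod_jA_j)/(a_j\sim x_j)$. $r:Y\to X$ is the retraction collapsing each $A_j$ to $x_j$; $r_j:Y\to A_j$ is the retraction collapsing $X$ and all $A_i$, $i\ne j$, to $a_j$. *)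

(* Defs.v *)
From HB Require Import structures.
From mathcomp Require Import all_boot all_order all_algebra.
From mathcomp Require Import all_classical all_reals topology normedtype.
Import numFieldTopology.Exports numFieldNormedType.Exports.
Set Implicit Arguments.
Unset Strict Implicit.
Unset Printing Implicit Defensive.
Import Order.TTheory GRing.Theory Num.Theory.
Local Open Scope classical_set_scope.
Local Open Scope ring_scope.

(* Points of (X ⊔ ∐_j A_j)/(a_j ~ x_j) are represented by the canonical *)
(* transversal: inl y (y : X), and inr (j, c) with c : A j, c <> a j.  *)
Section AdjSpace.
Context (X : topologicalType) (x : nat -> X)
        (A : nat -> topologicalType) (a : forall j, A j).

Definition adj_sum := (X + {j : nat & A j})%type.

(* P selects which wedge summands A_j are present *)
Definition adj_ok (P : nat -> Prop) (p : adj_sum) : Prop :=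
  match p with
  | inl _ => True
  | inr (existT j c) => P j /\ c <> a j
  end.

Definition adj_pts (P : nat -> Prop) := {p : adj_sum | adj_ok P p}.

Definition adj_inX (P : nat -> Prop) (y : X) : adj_pts P :=
  exist (adj_ok P) (inl y) I.

(* the quotient map restricted to A_j (identifies a_j with x_j) *)
Definition adj_inA (P : nat -> Prop) (j : nat) (Pj : P j) (c : A j) : adj_pts P :=
  match pselect (c = a j) with
  | left _ => adj_inX P (x j)
  | right h => exist (adj_ok P) (inr (existT _ j c)) (conj Pj h)
  end.

(* Y_k : X with A_j (j < k) attached; quotient topology of the disjoint  *)
(* union: U open iff its preimages in X and in each A_j (j<k) are open. *)
Definition adjY (k : nat) := adj_pts (fun j => (j < k)%N).

HB.instance Definition _ k := gen_eqMixin (adjY k).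
HB.instance Definition _ k := gen_choiceMixin (adjY k).

Definition adjY_open (k : nat) (U : set (adjY k)) : Prop :=
  open (adj_inX (fun j => (j < k)%N) @^-1` U) /\
  forall j (Pj : (j < k)%N), open (adj_inA Pj @^-1` U).

Lemma adjY_openT k : adjY_open [set: adjY k].
Proof. by split => [|j Pj]; rewrite preimage_setT; exact: openT. Qed.

Lemma adjY_openI k : setI_closed (@adjY_open k).
Proof.
move=> U V [U1 U2] [V1 V2]; split => [|j Pj]; rewrite preimage_setI.
  exact: openI.
exact: openI (U2 j Pj) (V2 j Pj).
Qed.

Lemma adjY_open_bigU k (I0 : Type) (f : I0 -> set (adjY k)) :
  (forall i, adjY_open (f i)) -> adjY_open (\bigcup_i f i).
Proof.
move=> oF; split => [|j Pj]; rewrite preimage_bigcup.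
  by apply: bigcup_open => i _; case: (oF i).
by apply: bigcup_open => i _; case: (oF i) => _; apply.
Qed.

HB.instance Definition _ k := isOpenTopological.Build (adjY k)
  (@adjY_openT k) (@adjY_openI k) (@adjY_open_bigU k).

Definition adj_car := adj_pts (fun _ => True).
HB.instance Definition _ := gen_eqMixin adj_car.
HB.instance Definition _ := gen_choiceMixin adj_car.

Definition adj_rho (k : nat) (p : adj_car) : adjY k :=
  match sval p with
  | inl y => adj_inX _ y
  | inr (existT j c) =>
      match pselect (j < k)%N with
      | left h => adj_inA h c
      | right _ => adj_inX _ (x j)
      end
  end.

(* Y = lim_k Y_k with the subspace topology of prod_k Y_k; adj_car maps  *)
(* bijectively onto the inverse limit via (adj_rho k)_k, so this is the  *)
(* initial topology of that map.                                          *)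
Definition adjYt (k : nat) : topologicalType := adjY k.
Definition adj_lim (p : adj_car) : prod_topology adjYt := fun k => adj_rho k p.
Definition Adj : Type := initial_topology adj_lim.
HB.instance Definition _ := Choice.copy Adj adj_car.
HB.instance Definition _ := Topological.copy Adj (initial_topology adj_lim).

Definition adj_base (y : X) : Adj := adj_inX (fun _ => True) y.

Definition adj_r (p : Adj) : X :=
  match sval p with inl y => y | inr (existT j _) => x j end.

Definition adj_rj (j : nat) (p : Adj) : A j :=
  match sval p with
  | inl _ => a j
  | inr (existT i c) =>
      match i =P j with
      | ReflectT e => eq_rect i A c j e
      | ReflectF _ => a j
      end
  end.

End AdjSpace.

Section Peano.
Context {R : realType}.

Definition path_in (T : topologicalType) (S : set T) (p q : T) : Prop :=
  exists g : R -> T, [/\ {within [set t : R | 0 <= t <= 1], continuous g},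
    g 0 = p, g 1 = q & g @` [set t : R | 0 <= t <= 1] `<=` S].

Definition path_connected_set (T : topologicalType) (S : set T) : Prop :=
  forall p q, S p -> S q -> path_in S p q.

Definition locally_path_connected (T : topologicalType) : Prop :=
  forall (p : T) (U : set T), nbhs p U ->
    exists V : set T, [/\ open V, V p, V `<=` U & path_connected_set V].

Definition peano_continuum (X : pseudoMetricType R) : Prop :=
  [/\ hausdorff_space X, compact [set: X], connected [set: X]
    & locally_path_connected X].

(* pi_n via maps (I^n, boundary) -> (T, t0), homotopy rel boundary,     *)
(* and concatenation in the first coordinate.                          *)
Definition cube (n : nat) : set 'rV[R]_n :=
  [set v | forall i, 0 <= v ord0 i <= 1].

Definition cube_bd (n : nat) : set 'rV[R]_n :=
  [set v | @cube n v /\ exists i, v ord0 i = 0 \/ v ord0 i = 1].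

Definition based_cube_map (T : topologicalType) (t0 : T) (n : nat)
  (f : 'rV[R]_n -> T) : Prop :=
  {within @cube n, continuous f} /\ (forall v, @cube_bd n v -> f v = t0).

Definition homotopic_rel (T : topologicalType) (t0 : T) (n : nat)
  (f g : 'rV[R]_n -> T) : Prop :=
  exists H : (R * 'rV[R]_n)%type -> T,
    [/\ {within [set p | 0 <= p.1 <= 1 /\ @cube n p.2], continuous H},
        (forall v, @cube n v -> H (0, v) = f v),
        (forall v, @cube n v -> H (1, v) = g v) &
        (forall t v, 0 <= t <= 1 -> @cube_bd n v -> H (t, v) = t0)].

Definition cube_concat (T : Type) (n : nat) (f g : 'rV[R]_n -> T)
  : 'rV[R]_n -> T := fun v =>
  if `[< forall i : 'I_n, (i : nat) = 0%N -> v ord0 i <= 1 / 2 >]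
  then f (\row_i (if (i : nat) == 0%N then 2 * v ord0 i else v ord0 i))
  else g (\row_i (if (i : nat) == 0%N then 2 * v ord0 i - 1 else v ord0 i)).

End Peano.

Arguments Adj {X} x {A} a.
Arguments adj_base {X} x {A} a y.
Arguments adj_r {X} x {A} a p.
Arguments adj_rj {X} x {A} a j p.

(* Main.v *)
Require Import Defs.
From HB Require Import structures.
From mathcomp Require Import all_boot all_order all_algebra.
From mathcomp Require Import all_classical all_reals topology normedtype.
From mathcomp Require Import interval_inference ring lra.
Import numFieldTopology.Exports numFieldNormedType.Exports.
Import Order.TTheory GRing.Theory Num.Theory.
Set Implicit Arguments.
Unset Strict Implicit.
Unset Printing Implicit Defensive.
Local Open Scope classical_set_scope.
Local Open Scope ring_scope.

(** Since the points of [Adj x a] are determined by their images under [r] and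
    the [r_j], a map into it is the same as a map [phi] into [X] together with
    maps [c_j] into the [A_j], at most one of which is off its base point at any
    given argument, and such that [phi] equals [x_j] wherever [c_j] is off [a_j];
    and such a family glues to a continuous map.

    Compactness and local path-connectedness of [X] give one path [gam] starting
    at [y0] which rests at [x_j] on an interval [J_j], the [J_j] having disjoint
    interiors.  The path is a uniform limit: [x_k] is reached by a small detour
    made while the previous path rests at a nearby earlier point.

    The section puts [g0] in the half [v_1 <= 1/2] of the cube; in the other half
    it follows [gam] in the direction of [v_1], damped to [y0] at the boundary,
    and puts [g_j] in a box whose [v_1]-side is [J_j].  As the boxes are stacked
    along [v_1] while classes are added along [v_0], the two maps compared in the
    homomorphism law differ by sliding all boxes simultaneously along [v_0]. *)

(** * Maps into the adjunction space *)

(** The fold map of the wedge of two copies of [Z] based at [b]: it is meant for pairs with at most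
    one entry off [b], and returns that entry. *)
Definition wedge_sum (Z : Type) (b p q : Z) : Z :=
  if `[< p = b >] then q else p.

Lemma wedge_sumr (Z : Type) (b p : Z) : wedge_sum b p b = p.
Proof. by rewrite /wedge_sum; case: asboolP => [->|]. Qed.

Lemma wedge_suml (Z : Type) (b q : Z) : wedge_sum b b q = q.
Proof. by rewrite /wedge_sum; case: asboolP. Qed.

Lemma comp_continuous (T U V : topologicalType) (f : T -> U) (g : U -> V) :
  continuous f -> continuous g -> continuous (fun t => g (f t)).
Proof. by move=> cf cg t; exact: continuous_comp (cf t) (cg (f t)). Qed.

Section Glue.
Context (T : topologicalType).

Lemma near_neq (Z : topologicalType) (hZ : hausdorff_space Z) (b : Z)
    (p : T -> Z) (v : T) :
  {for v, continuous p} -> p v <> b -> \forall w \near v, p w <> b.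
Proof.
move=> cp pvb; apply: (cp [set z | z <> b]); apply: open_nbhs_nbhs; split=> //.
rewrite (_ : [set z | z <> b] = ~` [set b])//; apply: closed_openC.
exact/accessible_closed_set1/hausdorff_accessible.
Qed.

(** Points of [Z] are closed, so a map that is off [b] at [v] stays off [b] nearby, and the sum
    agrees with it there. Where both maps are at [b], each is close to [b] nearby. *)
Lemma wedge_sum_continuous (Z : topologicalType) (b : Z) (p q : T -> Z) :
  hausdorff_space Z -> (forall v, p v = b \/ q v = b) ->
  continuous p -> continuous q -> 
  continuous (fun v => wedge_sum b (p v) (q v)).
Proof.
move=> hZ pq cp cq v.
have eq_l w : p w <> b -> wedge_sum b (p w) (q w) = p w.
  by rewrite /wedge_sum; case: asboolP.
have eq_r w : q w <> b -> wedge_sum b (p w) (q w) = q w.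
  by rewrite /wedge_sum; case: asboolP => // /[swap] ?; case: (pq w).
have [pv|pv] := pselect (p v = b); last first.
  move=> U; rewrite eq_l// => /(cp v) pU.
  by apply: filterS2 (near_neq hZ (cp v) pv) pU => w pw; rewrite /= eq_l.
have [qv|qv] := pselect (q v = b); last first.
  move=> U; rewrite eq_r// => /(cq v) qU.
  by apply: filterS2 (near_neq hZ (cq v) qv) qU => w qw; rewrite /= eq_r.
have wv : wedge_sum b (p v) (q v) = b by rewrite /wedge_sum; case: asboolP.
move=> U; rewrite wv => Ub.
have pU : \forall w \near v, U (p w) by apply: (cp v); rewrite pv.
have qU : \forall w \near v, U (q w) by apply: (cq v); rewrite qv.
by apply: filterS2 pU qU => w Up Uq; rewrite /= /wedge_sum; case: asboolP.
Qed.

End Glue.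

Section AdjGlue.
Context (X : topologicalType) (x : nat -> X)
        (A : nat -> topologicalType) (a : forall j, A j).

(* The point of [Adj] with [r]-coordinate [y] and [r_j]-coordinates [c j];
   meaningful when [adj_compat y c] holds. *)
Definition adj_glue (y : X) (c : forall j, A j) : Adj x a :=
  match pselect (exists j, c j <> a j) with
  | left h => adj_inA x a (P := fun=> True) (j := projT1 (cid h)) I
                (c (projT1 (cid h)))
  | right _ => adj_base x a y
  end.

Definition adj_compat (y : X) (c : forall j, A j) : Prop :=
  (forall j, c j <> a j -> y = x j) /\
  (forall i j, c i <> a i -> c j <> a j -> i = j).

Lemma adj_inA_base (P : nat -> Prop) j (Pj : P j) :
  adj_inA x a Pj (a j) = adj_inX a P (x j).
Proof. by rewrite /adj_inA; case: pselect. Qed.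

Lemma adj_glue_base y c : (forall j, c j = a j) -> adj_glue y c = adj_base x a y.
Proof. by rewrite /adj_glue => ca; case: pselect => // h; exfalso; case: h => j; apply. Qed.

Lemma adj_glue_inA y c j : adj_compat y c -> c j <> a j ->
  adj_glue y c = adj_inA x a (P := fun=> True) (j := j) I (c j).
Proof.
move=> [_ c1] cj; rewrite /adj_glue; case: pselect => [h|[]]; last by exists j.
by rewrite (c1 _ _ (projT2 (cid h)) cj).
Qed.

Lemma adj_r_glue y c : adj_compat y c -> adj_r x a (adj_glue y c) = y.
Proof.
move=> yc; have [[j cj]|ca] := pselect (exists j, c j <> a j); last first.
  by rewrite adj_glue_base// => j; apply: contrapT => cj; apply: ca; exists j.
rewrite (@adj_glue_inA _ _ j)// /adj_r /adj_inA.
by case: pselect => //= _; rewrite ((proj1 yc) j cj).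
Qed.

Lemma adj_rj_glue y c i : adj_compat y c -> adj_rj x a i (adj_glue y c) = c i.
Proof.
move=> yc; have [[j cj]|ca] := pselect (exists j, c j <> a j); last first.
  have {}ca j : c j = a j by apply: contrapT => cj; apply: ca; exists j.
  by rewrite adj_glue_base// ca.
rewrite (@adj_glue_inA _ _ j)// /adj_rj /adj_inA.
case: pselect => //= _; case: eqP => [e|ji]; first by case: _ / e.
by apply: contrapT => ci; apply: ji; apply: (proj2 yc) => //; apply: nesym.
Qed.

Lemma adj_rho_glue_inA k y c j (jk : (j < k)%N) : adj_compat y c -> c j <> a j ->
  adj_rho x k (adj_glue y c) = adj_inA x a jk (c j).
Proof.
move=> yc cj; rewrite (@adj_glue_inA _ _ j)// /adj_rho {1}/adj_inA.
case: pselect => //= _; case: pselect => // jk'.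
by congr (adj_inA x a _ (c j)); exact: bool_irrelevance.
Qed.

Lemma adj_rho_glue_inX k y c : adj_compat y c ->
  (forall j, (j < k)%N -> c j = a j) ->
  adj_rho x k (adj_glue y c) = adj_inX a (fun j => (j < k)%N) y.
Proof.
move=> yc ck; have [[j cj]|ca] := pselect (exists j, c j <> a j); last first.
  by rewrite adj_glue_base// => j; apply: contrapT => cj; apply: ca; exists j.
rewrite (@adj_glue_inA _ _ j)// /adj_rho {1}/adj_inA; case: pselect => //= _.
by case: pselect => [/ck //|_]; rewrite ((proj1 yc) j cj).
Qed.

(** The topology is initial for the projections to the [Y_k], and at level [k] only the finitely
    many [c j] with [j < k] are seen; the other summands are collapsed to their [x j], where [phi]
    already is. *)
Lemma adj_glue_continuous (T : topologicalType) (phi : T -> X)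
    (c : T -> forall j, A j) :
  hausdorff_space X -> (forall j, hausdorff_space (A j)) ->
  continuous phi -> (forall j, continuous (c ^~ j)) ->
  (forall v, adj_compat (phi v) (c v)) ->
  continuous (fun v => adj_glue (phi v) (c v)).
Proof.
move=> hX hA cphi cc yc; apply: continuous_comp_initial.
move=> v; apply/cvg_sup => k U [_ /= [[W oW <-]]] Wv /filterS; apply.
move: oW Wv => [/= WX WA]; rewrite /= /adj_lim => Wv.
have [[j [jk cj]]|ca] := pselect (exists j, (j < k)%N /\ c v j <> a j).
  have cW : \forall w \near v, W (adj_inA x a jk (c w j)).
    apply: (cc j v (adj_inA x a jk @^-1` W)).
    apply: open_nbhs_nbhs; split; first exact: WA.
    by rewrite /= -(@adj_rho_glue_inA _ (phi v)).
  have ca : \forall w \near v, c w j <> a j.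
    exact: (near_neq (hA j) (cc j v) cj).
  by apply: filterS2 cW ca => w Ww cw; rewrite /= (@adj_rho_glue_inA _ _ _ j jk).
have {}ca j : (j < k)%N -> c v j = a j.
  by move=> jk; apply: contrapT => cj; apply: ca; exists j.
rewrite adj_rho_glue_inX// in Wv.
have phiW : \forall w \near v, W (adj_inX a _ (phi w)).
  by apply: (cphi v (adj_inX a _ @^-1` W)); exact: open_nbhs_nbhs.
have cW : \forall w \near v, forall j : 'I_k, c w j <> a j ->
    W (adj_inA x a (ltn_ord j) (c w j)).
  apply: filter_forall => j.
  (* If [phi v] is not [x j], then neither is [phi w] for [w] near [v], and compatibility keeps
     [c w j] at the base point. Otherwise [W] contains the common point of [X] and [A j]. *)
  have [xj|xj] := pselect (phi v = x j); last first.
    apply: filterS (near_neq hX (cphi v) xj) => w phiw cw.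
    by have := proj1 (yc w) j cw.
  have : \forall w \near v, W (adj_inA x a (ltn_ord j) (c w j)).
    apply: (cc j v (adj_inA x a (ltn_ord j) @^-1` W)).
    apply: open_nbhs_nbhs; split; first exact: WA.
    by rewrite /= ca// adj_inA_base -xj.
  exact: filterS.
apply: filterS2 phiW cW => w Wphi Wc /=.
have [[j [jk cj]]|cw] := pselect (exists j, (j < k)%N /\ c w j <> a j).
  rewrite (@adj_rho_glue_inA _ _ _ j jk)//.
  by have := Wc (Ordinal jk) cj; rewrite (bool_irrelevance (ltn_ord (Ordinal jk)) jk).
rewrite adj_rho_glue_inX// => j jk.
by apply: contrapT => cj; apply: cw; exists j.
Qed.

End AdjGlue.

(** * Paths in Peano continua *)

Lemma within_comp_continuous (T U V : topologicalType) (D : set U)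
    (f : T -> U) (g : U -> V) :
  {within D, continuous g} -> continuous f -> (forall t, D (f t)) ->
  continuous (g \o f).
Proof.
move=> /subspace_continuousP cg cf Df t W gW.
have /(cf t) fW : nbhs (f t) [set y | D y -> W (g y)].
  exact: (cg (f t) (Df t) W gW).
change (\forall s \near t, W (g (f s))).
have {}fW : \forall s \near t, D (f s) -> W (g (f s)) := fW.
by apply: filterS fW => s; apply.
Qed.

Section Clamp.
Context {R : realType}.

(** The retraction of the line onto the unit interval; composing with it turns continuity within the
    interval into global continuity. *)
Definition clamp01 (t : R) : R := Num.max 0 (Num.min 1 t).

Lemma clamp01_itv t : 0 <= clamp01 t <= 1.
Proof. by rewrite /clamp01 le_max lexx ge_max ler01 ge_min lexx. Qed.

Lemma clamp01_id t : 0 <= t <= 1 -> clamp01 t = t.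
Proof. by case/andP => t0 t1; rewrite /clamp01 min_r// max_r. Qed.

Lemma clamp01_le0 t : t <= 0 -> clamp01 t = 0.
Proof. by move=> t0; rewrite /clamp01 max_l// ge_min t0 orbT. Qed.

Lemma clamp01_ge1 t : 1 <= t -> clamp01 t = 1.
Proof. by move=> t1; rewrite /clamp01 min_l// max_r. Qed.

Lemma clamp01_continuous : continuous clamp01.
Proof.
move=> t; apply: continuous_max; first exact: cst_continuous.
by apply: continuous_min; [exact: cst_continuous|exact: cvg_id].
Qed.

End Clamp.

Section Paths.
Context {R : realType}.

Lemma path_in_ext (T : topologicalType) (S : set T) (p q : T) :
  path_in (R := R) S p q -> exists g : R -> T,
    [/\ continuous g, forall t, t <= 0 -> g t = p, forall t, 1 <= t -> g t = q
      & forall t, S (g t)].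
Proof.
move=> [g [cg g0 g1 gS]]; exists (g \o clamp01); split.
- apply: within_comp_continuous cg clamp01_continuous _ => t.
  exact: clamp01_itv.
- by move=> t /clamp01_le0 /= ->.
- by move=> t /clamp01_ge1 /= ->.
- by move=> t; apply: gS; exists (clamp01 t) => //; exact: clamp01_itv.
Qed.

Lemma affine_continuous (m d : R) : continuous (fun t => m * t + d).
Proof.
move=> t; apply: cvgD; last exact: cvg_cst.
by apply: cvgM; [exact: cvg_cst|exact: cvg_id].
Qed.

(** Both paths are run at double speed and extended by constants. Each then rests at [q] while the
    other one moves, so their wedge sum at [q] is the concatenation. *)
Lemma path_in_trans (T : topologicalType) (S : set T) (p q r : T) :
  hausdorff_space T ->
  path_in (R := R) S p q -> path_in (R := R) S q r -> path_in (R := R) S p r.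
Proof.
move=> hT /path_in_ext [f [cf f0 f1 fS]] /path_in_ext [g [cg g0 g1 gS]].
exists (fun t => wedge_sum q (f (2 * t + 0)) (g (2 * t + -1))).
split.
- apply: continuous_subspaceT; apply: wedge_sum_continuous => //.
  + move=> t /=; have [th|th] := leP t (1 / 2); first by right; apply: g0; lra.
    by left; apply: f1; lra.
  + exact: comp_continuous (@affine_continuous 2 0) cf.
  + exact: comp_continuous (@affine_continuous 2 (-1)) cg.
- have fp : f (2 * 0 + 0) = p by apply: f0; lra.
  have gq : g (2 * 0 + -1) = q by apply: g0; lra.
  by rewrite fp gq wedge_sumr.
- have fq : f (2 * 1 + 0) = q by apply: f1; lra.
  have gr : g (2 * 1 + -1) = r by apply: g1; lra.
  by rewrite fq gr wedge_suml.
- move=> _ [t _ <-]; rewrite /wedge_sum /=.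
  by case: asboolP => ?; [exact: gS|exact: fS].
Qed.

(** The points that can be joined to [p] form a nonempty clopen set. *)
Lemma connected_path_connected (T : topologicalType) :
  hausdorff_space T -> connected [set: T] ->
  locally_path_connected (R := R) T ->
  forall p q : T, path_in (R := R) setT p q.
Proof.
move=> hT cT lT p q; pose B := [set z | path_in (R := R) setT p z].
have sT (V : set T) u v : path_in (R := R) V u v -> path_in (R := R) setT u v.
  by move=> [g [? ? ? _]]; exists g.
suff : B = setT by move=> BT; have : B q by rewrite BT.
apply: cT.
- exists p; exists (cst p); split=> //.
  by apply: continuous_subspaceT => t; exact: cst_continuous.
- exists B; last by rewrite setTI.
  rewrite openE => z Bz; have [V [oV Vz _ pV]] := lT z setT filterT.
  apply: filterS (open_nbhs_nbhs (conj oV Vz)) => w Vw.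
  by apply: path_in_trans Bz _ => //; apply: sT (pV _ _ Vz Vw).
- exists B; last by rewrite setTI.
  rewrite -openC openE => z Bz; have [V [oV Vz _ pV]] := lT z setT filterT.
  apply: filterS (open_nbhs_nbhs (conj oV Vz)) => w Vw Bw; apply: Bz.
  by apply: path_in_trans Bw _ => //; apply: sT (pV _ _ Vw Vz).
Qed.

(** Around each [p] there is a path-connected [V] within [e / 2] of [p], containing a ball of radius
    [r]. Centres [p'] within [r / 2] of [p] and radii below [r / 2] keep both ends in [V], hence the
    path within [e] of [p']. Compactness makes the radius uniform. *)
Lemma compact_uniformly_locally_path_connected (X : pseudoMetricType R) :
  compact [set: X] -> locally_path_connected (R := R) X ->
  forall e : R, 0 < e -> exists2 d : R, 0 < d &
    forall p q : X, ball p d q -> path_in (R := R) (ball p e) p q.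
Proof.
move=> /compact_near_coveringP cX lX e e0.
have := cX _ (0^'+ : set_system R)
  (fun d p => forall q, ball p d q -> path_in (R := R) (ball p e) p q) _.
case=> [p _|d /= d0 dP].
  have e20 : 0 < e / 2 by lra.
  have [V [oV Vp Ve pV]] := lX p _ (nbhsx_ballx p _ e20).
  have /nbhs_ballP[r /= r0 rV] := open_nbhs_nbhs (conj oV Vp).
  have r20 : 0 < r / 2 by lra.
  near=> p' d => q p'q.
  have pp' : ball p (r / 2) p' by near: p'; exact: nbhsx_ballx.
  have dr : d < r / 2 by near: d; exact: nbhs_right_lt.
  have Vq : V q.
    apply: rV; rewrite (splitr r); apply: ball_triangle pp' _.
    exact: le_ball (ltW dr) _ p'q.
  have Vp' : V p' by apply: rV; apply: le_ball pp'; lra.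
  have [g [cg g0 g1 gV]] := pV _ _ Vp' Vq; exists g; split=> //.
  move=> z /gV /Ve pz; rewrite (splitr e); apply: ball_triangle pz.
  exact/ball_sym/Ve.
exists (d / 2); first by lra.
move=> p q; apply: (dP (d / 2)) => //=.
  by rewrite sub0r normrN ger0_norm; lra.
by rewrite divr_gt0.
Unshelve. all: by end_near. Qed.

(** Near a given point [p], either no term of the sequence comes within [d / 2] of [p], or one such
    term [x i] serves all the terms that do. Compactness bounds the indices [i] used. *)
Lemma compact_finite_net (X : pseudoMetricType R) (x : nat -> X) :
  compact [set: X] -> forall d : R, 0 < d ->
  exists N, forall j, exists2 i, (i < N)%N & ball (x i) d (x j).
Proof.
move=> /compact_near_coveringP cX d d0.
have := cX _ (\oo : set_system nat) (fun N p => forall j, ball p (d / 4) (x j) ->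
  exists2 i, (i < N)%N & ball (x i) d (x j)) _.
case=> [p _|N _ NP].
  have d40 : 0 < d / 4 by lra.
  have tri p' j : ball p (d / 4) p' -> ball p' (d / 4) (x j) -> ball p (d / 2) (x j).
    by move=> pp' p'j; rewrite (_ : d / 2 = d / 4 + d / 4); [exact: ball_triangle p'j|lra].
  have [[i pi]|ni] := pselect (exists i, ball p (d / 2) (x i)); last first.
    near=> p' N => j p'j; exfalso; apply: ni; exists j; apply: tri p'j.
    by near: p'; exact: nbhsx_ballx.
  near=> p' N.
  have iN : (i < N)%N by near: N; exact: nbhs_infty_gt.
  have pp' : ball p (d / 4) p' by near: p'; exact: nbhsx_ballx.
  move=> j p'j; exists i => //.
  rewrite (splitr d); apply: ball_triangle (tri p' j pp' p'j).
  exact: ball_sym.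
exists N => j; apply: (NP N (leqnn N) (x j)) => //.
by apply: ballxx; lra.
Unshelve. all: by end_near. Qed.

End Paths.

(** * Inserting rests into a path by detours *)

Section PeanoPath.
Context {R : realType} (X : pseudoMetricType R) (x : nat -> X).
Hypothesis hX : hausdorff_space X.

Record stage := Stage {
  stage_size : nat;
  stage_path : R -> X;
  stage_lo : nat -> R;
  stage_mid : nat -> R;
  stage_hi : nat -> R }.

(* The path rests at [x i] on [lo i, hi i]; the part [lo i, mid i] is kept
   forever, and later detours start inside [mid i, hi i]. *)
Definition stage_ok (s : stage) : Prop :=
  [/\ continuous (stage_path s),
      forall i, (i < stage_size s)%N ->
        [/\ 0 <= stage_lo s i, stage_lo s i < stage_mid s i,
            stage_mid s i < stage_hi s i & stage_hi s i <= 3 / 4],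
      forall i t, (i < stage_size s)%N ->
        stage_lo s i <= t <= stage_hi s i -> stage_path s t = x i &
      forall i j, (i < stage_size s)%N -> (j < stage_size s)%N -> i <> j ->
        stage_hi s i <= stage_lo s j \/ stage_hi s j <= stage_lo s i].

Definition stage_extends (E : X -> set X) (s s' : stage) : Prop :=
  [/\ (stage_size s <= stage_size s')%N,
      forall i, (i < stage_size s)%N ->
        [/\ stage_lo s' i = stage_lo s i, stage_mid s' i = stage_mid s i
          & stage_hi s' i <= stage_hi s i] &
      forall t, E (stage_path s t) (stage_path s' t)].

Lemma tent_continuous (s L : R) :
  continuous (fun t => Num.min (4 * (t - s) / L) (4 * (s + L - t) / L)).
Proof.
pose f t : R := 4 * (t - s) / L; pose g t : R := 4 * (s + L - t) / L.
have fE : f = (fun t => 4 / L * t + - (4 * s / L)) by apply/funext => u; rewrite /f /g; ring.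
have gE : g = (fun t => - (4 / L) * t + (4 * (s + L) / L)).
  by apply/funext => u; rewrite /f /g; ring.
have cf : continuous f by rewrite fE; exact: affine_continuous.
have cg : continuous g by rewrite gE; exact: affine_continuous.
by move=> t; exact: (continuous_min (cf t) (cg t)).
Qed.

(** During the last part of its rest at [x p] the path is sent to the new point and back, and it
    pauses there in the middle of the detour. *)
Lemma stage_insert (S : set X) (s : stage) (p : nat) :
  stage_ok s -> (p < stage_size s)%N ->
  path_in (R := R) S (x p) (x (stage_size s)) ->
  exists s', [/\ stage_ok s', stage_size s' = (stage_size s).+1,
    forall i, (i < stage_size s)%N ->
        [/\ stage_lo s' i = stage_lo s i, stage_mid s' i = stage_mid s i
          & stage_hi s' i <= stage_hi s i] &
    forall t, stage_path s' t = stage_path s t \/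
      (stage_lo s p <= t <= stage_hi s p /\ S (stage_path s' t))].
Proof.
case: s => N gam a b c [/= cgam abc gx dis] pN /path_in_ext [g [cg g0 g1 gS]].
have [ap abp bcp cp] := abc p pN.
set m := (b p + c p) / 2; set L := (c p - b p) / 2.
have L0 : 0 < L by rewrite /L; lra.
have mL : m + L = c p by rewrite /m /L; lra.
have bm : b p < m by rewrite /m; lra.
(* Zero at both ends of [[m, c p]] and at least 1 on its middle half. Values outside the unit
   interval do no harm, because [g] is constant beyond its ends. *)
pose tent t := Num.min (4 * (t - m) / L) (4 * (m + L - t) / L).
have tent0 t : t <= m \/ c p <= t -> tent t <= 0.
  rewrite /tent ge_min !ler_pdivrMr// !mul0r => tm; apply/orP.
  by case: tm => tm; [left|right]; lra.
have tent1 t : m + L / 4 <= t <= m + 3 * L / 4 -> 1 <= tent t.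
  by move=> ?; rewrite /tent le_min !ler_pdivlMr// !mul1r; apply/andP; split; lra.
pose det := g \o tent.
have det0 t : t <= m \/ c p <= t -> det t = x p by move=> /tent0 /g0.
have gam' t : wedge_sum (x p) (gam t) (det t) = gam t \/
    (m <= t <= c p /\ wedge_sum (x p) (gam t) (det t) = det t).
  rewrite /wedge_sum; case: asboolP => [gt|]; last by left.
  have [tm|tm] := leP t m; first by left; rewrite det0 ?gt//; left.
  have [tc|tc] := leP t (c p); last by left; rewrite det0 ?gt//; right; exact: ltW.
  by right; rewrite ltW.
have det_eq t : m <= t <= c p -> wedge_sum (x p) (gam t) (det t) = det t.
  move=> tm; rewrite /wedge_sum; case: asboolP => // -[].
  by apply: gx => //; lra.
(* The new rest is the middle half of the detour. The rest at [x p] is cut at [m], which is still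
   beyond its [mid], so its permanent part survives and further detours can start from it. *)
exists (Stage N.+1 (fun t => wedge_sum (x p) (gam t) (det t))
  (fun i => if i == N then m + L / 4 else a i)
  (fun i => if i == N then m + L / 2 else b i)
  (fun i => if i == N then m + 3 * L / 4 else if i == p then m else c i)).
split=> //=; first split=> /=.
- apply: wedge_sum_continuous => //; last first.
    by move=> t; apply: continuous_comp; [exact: tent_continuous|exact: cg].
  move=> t; have [tm|tm] := leP t m; first by right; apply: det0; left.
  have [tc|tc] := leP t (c p); last by right; apply: det0; right; exact: ltW.
  by left; apply: gx => //; lra.
- move=> i; rewrite ltnS leq_eqVlt; have [-> _|iN /= iN'] := eqVneq i N.
    by split; lra.
  have [? ? ? ?] := abc i iN'; case: eqVneq => [ip|_]; last by split.
  by subst i; split => //; lra.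
- move=> i t; rewrite ltnS leq_eqVlt; have [-> _|iN /= iN'] := eqVneq i N.
    move=> tm; rewrite det_eq; last lra.
    by rewrite /det /= g1//; exact: tent1.
  move=> ti; have gxt : gam t = x i.
    apply: gx => //; move: ti; case: eqVneq => [->|_ //]; lra.
  case: (gam' t) => [->//|[tm]].
  have [ip|ip] := eqVneq i p.
    subst i; move: ti; rewrite eqxx => ti ->; apply: det0; left; lra.
  rewrite -gxt; have /eqP ip' := ip.
  move: ti; rewrite (negPf ip) => ti.
  have [? ? ? ?] := abc i iN'.
  (* Another rest can meet the detour only at an end, and there the detour is at [x p]. *)
  have xip : t = c p \/ t = m.
    by case: (dis i p iN' pN ip') => ?; [right|left]; lra.
  rewrite /wedge_sum; case: asboolP => //= gxp _; rewrite gxp.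
  by apply: det0; case: xip => ->; [right|left].
- move=> i j; rewrite 2!ltnS (leq_eqVlt i) (leq_eqVlt j).
  have [->|iN] := eqVneq i N; have [->|jN] := eqVneq j N => //=.
  + move=> _ jN' _; case: eqVneq => [->|/eqP jp]; first by right; lra.
    by have [? ? ? ?] := abc j jN'; case: (dis j p jN' pN jp) => ?; [right|left]; lra.
  + move=> iN' _ _; case: eqVneq => [->|/eqP ip]; first by left; lra.
    by have [? ? ? ?] := abc i iN'; case: (dis i p iN' pN ip) => ?; [left|right]; lra.
  + move=> iN' jN' ij; have := dis i j iN' jN' ij.
    by case: (eqVneq i p) => [ip|_]; case: (eqVneq j p) => [jp|_];
      subst; case=> ?; try (by left; lra); right; lra.
- move=> i iN; rewrite (ltn_eqF iN); split=> //.
  by case: eqVneq => [->|_ //]; lra.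
- move=> t; case: (gam' t) => [->|[tm ->]]; first by left.
  by right; split; [lra|exact: gS].
Qed.

(** All detours start from points placed in [s] itself, inside their rests in [s]. At such times the
    path of [s] is at [x p], so each detour is compared directly with [s] and the errors of the [M]
    insertions do not add up. *)
Lemma stage_insert_many (E : X -> set X) (s : stage) (M : nat) :
  (forall p, E p p) -> stage_ok s ->
  (forall m, exists2 p, (p < stage_size s)%N &
     path_in (R := R) (E (x p)) (x p) (x m)) ->
  exists s', [/\ stage_ok s', stage_size s' = (stage_size s + M)%N
    & stage_extends E s s'].
Proof.
move=> Er sok pE; elim: M => [|M [s' [s'ok s'M [_ s's s'E]]]].
  by exists s; rewrite addn0; split.
have [p ps pP] := pE (stage_size s').
have ps' : (p < stage_size s')%N by rewrite s'M ltn_addr.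
have [s'' [s''ok s''M s''s s''E]] := stage_insert s'ok ps' pP.
exists s''; split=> //; first by rewrite s''M s'M addnS.
split.
- by rewrite s''M s'M -addnS leq_addr.
- move=> i si; have [|-> -> h] := s''s i; first by rewrite s'M ltn_addr.
  by have [-> -> h'] := s's i si; split=> //; exact: le_trans h'.
- move=> t; case: (s''E t) => [->//|[tp pt]].
  have [_ _ sx _] := sok; have [lo _ hi] := s's p ps.
  by rewrite (sx p)//; case/andP: tp; rewrite lo => -> /= /le_trans; apply.
Qed.

End PeanoPath.

(** * The limit path resting at every point of the sequence *)

Section PeanoPathLimit.
Context {R : realType} (X : pseudoMetricType R).

Lemma half_expr_lt (e : R) : 0 < e -> exists l, 2^-1 ^+ l < e.
Proof.
move=> e0; have [l _ /(_ l (leqnn l)) le] := near_infty_natSinv_expn_lt (PosNum e0).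
by exists l; rewrite exprVn -div1r.
Qed.

Lemma half_ball_iter (u : nat -> X) :
  (forall l, ball (u l) (2^-1 ^+ l : R) (u l.+1)) ->
  forall k l, ball (u l) (2 * 2^-1 ^+ l : R) (u (l + k)%N).
Proof.
move=> uS; elim=> [|k IH] l.
  by rewrite addn0; apply: ballxx; rewrite mulr_gt0// exprn_gt0// invr_gt0.
have -> : 2 * 2^-1 ^+ l = 2^-1 ^+ l + 2 * 2^-1 ^+ l.+1 :> R.
  by rewrite exprS mulrA mulfV ?mul1r// mulr2n mulrDl mul1r.
by rewrite addnS -addSn; apply: ball_triangle (uS l) (IH l.+1).
Qed.

Lemma ball_cst_eq (p q : X) : hausdorff_space X ->
  (forall l, ball p (3 * 2^-1 ^+ l : R) q) -> p = q.
Proof.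
move=> hX pq; apply: close_eq => //; rewrite ball_close => e.
have e30 : 0 < e%:num / 3 by rewrite divr_gt0.
have [l le] := half_expr_lt e30.
by apply: le_ball (pq l); rewrite -ler_pdivlMl// mulrC ltW.
Qed.

Lemma half_uniform_limit (gam : nat -> R -> X) :
  compact [set: X] -> (forall l, continuous (gam l)) ->
  (forall l t, ball (gam l t) (2^-1 ^+ l : R) (gam l.+1 t)) ->
  exists2 g : R -> X, continuous g &
    forall l t, ball (gam l t) (3 * 2^-1 ^+ l : R) (g t).
Proof.
move=> cX cgam gS.
have h0 l : 0 < 2^-1 ^+ l :> R by rewrite exprn_gt0// invr_gt0.
have [g gP] : {g : R -> X & forall t l, ball (gam l t) (3 * 2^-1 ^+ l : R) (g t)}.
  apply: (@choice _ _ (fun t z => forall l, ball (gam l t) (3 * 2^-1 ^+ l : R) z)) => t.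
  (* Compactness supplies a cluster point as the value of the limit. The terms after [l] lie within
     twice [2^-1 ^+ l], and passing to the cluster point costs one more such radius, whence the
     factor 3. *)
  have [|z [_ zP]] := cX ((gam ^~ t) @ \oo) _; first exact: filterT.
  exists z => l.
  have lU : \forall m \near \oo, ball (gam l t) (2 * 2^-1 ^+ l : R) (gam m t).
    near=> m; have lm : (l <= m)%N by near: m; exact: nbhs_infty_ge.
    by rewrite -(subnKC lm); exact: (half_ball_iter (gS ^~ t)).
  have [w [lw zw]] := zP _ _ lU (nbhsx_ballx z _ (h0 l)).
  rewrite (_ : 3 * _ = 2 * 2^-1 ^+ l + 2^-1 ^+ l); last by ring.
  by apply: ball_triangle lw _; exact: ball_sym.
exists g => [t|l t]; last exact: gP.
apply/cvg_ballP => e e0.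
(* Then three times [2^-1 ^+ l] is below [e / 3], which leaves a third of [e] for each of the three
   steps of the estimate. *)
have e90 : 0 < e / 9 by lra.
have [l le] := half_expr_lt e90.
have e30 : 0 < e / 3 by lra.
have /cvg_ballP /(_ _ e30) := cgam l t; apply: filterS => t' tt'.
have gl u : ball (gam l u) (e / 3) (g u) by apply: le_ball (gP u l); lra.
rewrite (_ : e = e / 3 + e / 3 + e / 3); last by lra.
by apply: ball_triangle (gl t'); apply: ball_triangle tt'; exact/ball_sym/gl.
Unshelve. all: by end_near. Qed.

Lemma peano_path (y0 : X) (x : nat -> X) : peano_continuum X ->
  exists (g : R -> X) (a b : nat -> R),
  [/\ continuous g, g 0 = y0,
      forall j, [/\ 1 / 4 <= a j, a j < b j & b j <= 3 / 4],
      forall i j, i <> j -> b i <= a j \/ b j <= a i &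
      forall j t, a j <= t <= b j -> g t = x j].
Proof.
(* The base point is put in front of the sequence, so that the start of the path is one more rest;
   the indices of the [x j] are shifted by one. *)
move=> [hX cX coX lX]; pose z j := if j is j'.+1 then x j' else y0.
have h0 l : 0 < 2^-1 ^+ l :> R by rewrite exprn_gt0// invr_gt0.
pose E l (p : X) := ball p (2^-1 ^+ l : R).
have [d dP] : {d : nat -> R & forall l, 0 < d l /\
    forall p q : X, ball p (d l) q -> path_in (R := R) (E l p) p q}.
  apply: (@choice _ _ (fun l d => 0 < d /\
    forall p q : X, ball p d q -> path_in (R := R) (E l p) p q)) => l.
  have [d d0 dP] := compact_uniformly_locally_path_connected cX lX (h0 l).
  by exists d.
pose net l (s : stage X) :=
  forall j, exists2 i, (i < stage_size s)%N & ball (z i) (d l) (z j).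
have net_mono l s N : (N <= stage_size s)%N ->
    (forall j, exists2 i, (i < N)%N & ball (z i) (d l) (z j)) -> net l s.
  by move=> Ns sP j; have [i iN ij] := sP j; exists i => //; exact: leq_trans Ns.
(* At a good stage every point of the sequence is close enough to a placed one to be reached by a
   detour of size [2^-1 ^+ l], and the points up to index [l] are placed. *)
pose good l (s : stage X) := [/\ stage_ok z s, net l s & (l < stage_size s)%N].
have [s0 [s0ok s00 s01]] : exists s0, [/\ good 0%N s0, stage_lo s0 0 = 0
    & stage_mid s0 0 = 1 / 4].
  (* The constant path, with [[0, 1/4]] reserved for [y0]; this forces the intervals of all later
     points into [[1/4, 3/4]]. *)
  pose s := Stage 1 (cst y0 : R -> X) (cst 0) (cst (1 / 4)) (cst (3 / 4)).
  have sok : stage_ok z s.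
    rewrite /s /cst; split=> /=.
    - by move=> t; exact: cst_continuous.
    - by move=> i _; split; lra.
    - by move=> [|i].
    - by move=> [|i] [|j].
  have [N NP] := compact_finite_net z cX (proj1 (dP 0%N)).
  (* The first detours may have any size: [E] is trivial here, and path-connectedness of [X]
     provides them. *)
  have [||m|s' [s'ok s'N [_ s's _]]] :=
      @stage_insert_many _ _ z hX (fun=> setT) s N => //.
    exists 0%N => //; exact: connected_path_connected.
  have [//|lo mid _] := s's 0%N; exists s'; split=> //; split=> //.
    by apply: net_mono NP; rewrite s'N leq_addl.
  by rewrite s'N.
have [f fP] : {f : nat * stage X -> stage X & forall ls, good ls.1 ls.2 ->
    good ls.1.+1 (f ls) /\ stage_extends (E ls.1) ls.2 (f ls)}.
  apply: (@choice _ _ (fun ls s' => good ls.1 ls.2 ->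
    good ls.1.+1 s' /\ stage_extends (E ls.1) ls.2 s')) => -[l s] /=.
  have [[sok sn ls]|sN] := pselect (good l s); last by exists s.
  have [N NP] := compact_finite_net z cX (proj1 (dP l.+1)).
  (* Adding [N] points places the finer net, and one more makes the number of placed points exceed
     [l.+1]. *)
  have [||m|s' [s'ok s'N ss']] := @stage_insert_many _ _ z hX (E l) s N.+1 => //.
  - by move=> p; apply: ballxx.
  - by have [i iN im] := sn m; exists i => //; exact: (proj2 (dP l)).
  exists s' => _; split=> //; split=> //.
    by apply: net_mono NP; rewrite s'N -addSnnS leq_addl.
  by rewrite s'N addnS ltnS ltn_addr.
pose sq := fix sq l := if l is l'.+1 then f (l', sq l') else s0.
have sqok l : good l (sq l).
  by elim: l => //= l /(fP (l, sq l)) [].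
have sqS l : stage_extends (E l) (sq l) (sq l.+1).
  by have [] := fP (l, sq l) (sqok l).
have sq_fix i l k : (i < stage_size (sq l))%N ->
    [/\ (i < stage_size (sq (l + k)%N))%N,
    stage_lo (sq (l + k)%N) i = stage_lo (sq l) i &
    stage_mid (sq (l + k)%N) i = stage_mid (sq l) i].
  move=> il; elim: k => [|k [ik lo mid]]; first by rewrite addn0.
  rewrite addnS; have [le ext _] := sqS (l + k)%N.
  have [-> -> _] := ext _ ik; split=> //; exact: leq_trans ik le.
have size_sq l : (l < stage_size (sq l))%N by have [] := sqok l.
have [l|l t|g cg gP] := @half_uniform_limit (fun l => stage_path (sq l)) cX.
- by have [[]] := sqok l.
- by have [_ _] := sqS l; apply.
(* At stage [i] the point [z i] is placed, so these two values are final; [stage_hi] may still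
   shrink, which is why the interval ends at [stage_mid]. *)
pose a i := stage_lo (sq i) i; pose b i := stage_mid (sq i) i.
have abE i l : (i <= l)%N -> stage_lo (sq l) i = a i /\ stage_mid (sq l) i = b i.
  move=> il; have [_ lo mid] := sq_fix i i (l - i)%N (size_sq i).
  by rewrite subnKC// in lo mid.
have sizeE i l : (i <= l)%N -> (i < stage_size (sq l))%N.
  by move=> il; exact: leq_ltn_trans (size_sq l).
have ab i : [/\ 0 <= a i, a i < b i & b i < 3 / 4].
  have [[_ /(_ i (size_sq i)) [? ? ? ?] _ _] _ _] := sqok i.
  by split=> //; rewrite /b; lra.
have dis i j : i <> j -> b i <= a j \/ b j <= a i.
  move=> ij; pose l := maxn i j.
  have il : (i <= l)%N by exact: leq_maxl.
  have jl : (j <= l)%N by exact: leq_maxr.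
  have [[_ abc _ /(_ i j (sizeE _ _ il) (sizeE _ _ jl) ij) dij] _ _] := sqok l.
  have [_ _ + _] := abc i (sizeE _ _ il); have [_ _ + _] := abc j (sizeE _ _ jl).
  move: dij; have [-> ->] := abE i l il; have [-> ->] := abE j l jl.
  by case=> ? ? ?; [left|right]; lra.
have gz i t : a i <= t <= b i -> g t = z i.
  (* From stage [i] on all paths are at [z i] at time [t], so [g t] is within every radius of the
     estimate. *)
  move=> tab; apply/esym/ball_cst_eq => // l; pose m := maxn i l.
  have im : (i <= m)%N by exact: leq_maxl.
  have <- : stage_path (sq m) t = z i.
    have [[_ abc sx _] _ _] := sqok m; apply: sx; first exact: sizeE.
    have [_ _ + _] := abc i (sizeE _ _ im).
    by have [-> ->] := abE i m im => ?; lra.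
  apply: le_ball (gP m t); rewrite ler_pM2l//; apply: ler_wiXn2l; last exact: leq_maxr.
    by lra.
  by lra.
have a0 : a 0%N = 0 by exact: s00.
have b0 : b 0%N = 1 / 4 by exact: s01.
exists g, (fun j => a j.+1), (fun j => b j.+1); split=> //.
- by rewrite (gz 0%N)// a0 b0; lra.
- move=> j; have [? ? ?] := ab j.+1; have [|?|?] := dis 0%N j.+1; first by [].
    by split; lra.
  by split; lra.
- by move=> i j ij; apply: dis => -[].
- by move=> j t /gz.
Qed.

End PeanoPathLimit.

(** * Based maps of cubes *)

Section Pairs.
Context (T U V : topologicalType).

Lemma pair_continuous (f : T -> U) (g : T -> V) :
  continuous f -> continuous g -> continuous (fun t => (f t, g t)).
Proof. by move=> cf cg t; exact: (cvg_pair (cf t) (cg t)). Qed.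

Lemma fst_continuous : continuous (fun p : T * U => p.1).
Proof. by move=> p; exact: cvg_fst. Qed.

Lemma snd_continuous : continuous (fun p : T * U => p.2).
Proof. by move=> p; exact: cvg_snd. Qed.

End Pairs.

Section RealContinuity.
Context {R : realType} (T : topologicalType).
Implicit Types f g : T -> R.

Lemma cstf_continuous (r : R) : continuous (fun _ : T => r).
Proof. by move=> t; exact: cst_continuous. Qed.

Lemma addf_continuous f g : continuous f -> continuous g ->
  continuous (fun t => f t + g t).
Proof. by move=> cf cg t; exact: (cvgD (cf t) (cg t)). Qed.

Lemma mulf_continuous f g : continuous f -> continuous g ->
  continuous (fun t => f t * g t).
Proof. by move=> cf cg t; exact: (cvgM (cf t) (cg t)). Qed.

Lemma oppf_continuous f : continuous f -> continuous (fun t => - f t).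
Proof. by move=> cf t; exact: (cvgN (cf t)). Qed.

Lemma maxf_continuous f g : continuous f -> continuous g ->
  continuous (fun t => Num.max (f t) (g t)).
Proof. by move=> cf cg t; exact: (continuous_max (cf t) (cg t)). Qed.

Lemma minf_continuous f g : continuous f -> continuous g ->
  continuous (fun t => Num.min (f t) (g t)).
Proof. by move=> cf cg t; exact: (continuous_min (cf t) (cg t)). Qed.

Lemma clampf_continuous f : continuous f -> continuous (fun t => clamp01 (f t)).
Proof. by move=> cf; exact: comp_continuous cf clamp01_continuous. Qed.

Lemma coordf_continuous n (f : T -> 'rV[R]_n) i :
  continuous f -> continuous (fun t => f t ord0 i).
Proof. by move=> cf; exact: comp_continuous cf (@coord_continuous _ _ _ _ _). Qed.

Lemma row_continuous n (f : 'I_n -> T -> R) :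
  (forall i, continuous (f i)) -> continuous (fun t => \row_i f i t : 'rV[R]_n).
Proof.
move=> cf t U [/= P tP PU].
have fP : \forall s \near t, forall i, P ord0 i (f i s).
  apply: filter_forall => i; apply: (cf i t).
  by have := tP ord0 i; rewrite mxE.
change (\forall s \near t, U (\row_i f i s)).
apply: filterS fP => s sP; apply: PU => i j.
by rewrite mxE (ord1 i).
Qed.

End RealContinuity.

Ltac solve_continuous :=
  repeat first
   [ exact: cstf_continuous
   | exact: fst_continuous
   | exact: snd_continuous
   | exact: coord_continuous
   | assumption
   | apply: row_continuous => ?
   | apply: addf_continuous
   | apply: oppf_continuous
   | apply: mulf_continuous
   | apply: maxf_continuous
   | apply: minf_continuous
   | apply: clampf_continuous
   | apply: coordf_continuous ].

Section CubeMaps.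
Context {R : realType} {n : nat}.
Implicit Types v w : 'rV[R]_n.

Definition clamp_row v : 'rV[R]_n := \row_i clamp01 (v ord0 i).

Lemma clamp_row_cube v : cube (clamp_row v).
Proof. by move=> i; rewrite mxE clamp01_itv. Qed.

Lemma clamp_row_id v : cube v -> clamp_row v = v.
Proof. by move=> vc; apply/rowP => i; rewrite mxE clamp01_id. Qed.

Lemma clamp_row_continuous : continuous clamp_row.
Proof.
apply: row_continuous => i; apply: clampf_continuous.
exact: coord_continuous.
Qed.

Definition inside v := forall i, 0 < v ord0 i < 1.

Lemma outsideP v : ~ inside v -> exists i, v ord0 i <= 0 \/ 1 <= v ord0 i.
Proof.
move=> /existsNP [i vi]; exists i.
have [|v0] := leP (v ord0 i) 0; first by left.
by have [|v1] := leP 1 (v ord0 i); [right|case: vi; rewrite v0].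
Qed.

Lemma cube_bd_clamp_row v : ~ inside v -> cube_bd (clamp_row v).
Proof.
move=> /outsideP [i vi]; split; first exact: clamp_row_cube.
exists i; rewrite mxE; case: vi => [/clamp01_le0|/clamp01_ge1]; by [left|right].
Qed.

Lemma cube_bd_outside v : cube_bd v -> ~ inside v.
Proof. by move=> [_ [i [vi|vi]]] /(_ i); rewrite vi ltxx ?andbF. Qed.

Section Target.
Context (T : topologicalType) (t0 : T).
Implicit Types f g : 'rV[R]_n -> T.

(** For a based map this is the extension by [t0] off the open cube, so a point where it differs
    from [t0] is known to be inside. *)
Definition cube_ext f : 'rV[R]_n -> T := f \o clamp_row.

Lemma cube_ext_id f v : cube v -> cube_ext f v = f v.
Proof. by move=> vc; rewrite /cube_ext /= clamp_row_id. Qed.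

Lemma cube_ext_continuous f : based_cube_map t0 f -> continuous (cube_ext f).
Proof.
move=> [cf _]; apply: within_comp_continuous cf clamp_row_continuous _.
exact: clamp_row_cube.
Qed.

Lemma cube_ext_outside f v : based_cube_map t0 f -> ~ inside v ->
  cube_ext f v = t0.
Proof. by move=> [_ f0] /cube_bd_clamp_row /f0. Qed.

Lemma cube_ext_neq f v : based_cube_map t0 f -> cube_ext f v <> t0 -> inside v.
Proof. by move=> f0 fv; apply: contrapT => /(cube_ext_outside f0). Qed.

Lemma based_cube_map_global f g : continuous g ->
  (forall v, cube v -> f v = g v) -> (forall v, ~ inside v -> g v = t0) ->
  based_cube_map t0 f.
Proof.
move=> cg fg g0; split; last first.
  by move=> v vbd; rewrite fg; [exact/g0/cube_bd_outside|exact: (proj1 vbd)].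
apply: (subspace_eq_continuous (f := g)); last exact: continuous_subspaceT.
by move=> v; rewrite inE => vc; exact: esym (fg v vc).
Qed.

Lemma homotopic_rel_global f g (K : R * 'rV[R]_n -> T) :
  continuous K -> (forall v, cube v -> K (0, v) = f v) ->
  (forall v, cube v -> K (1, v) = g v) ->
  (forall t v, ~ inside v -> K (t, v) = t0) -> homotopic_rel t0 f g.
Proof.
move=> cK Kf Kg K0; exists K; split=> //; first exact: continuous_subspaceT.
by move=> t v _ /cube_bd_outside; exact: K0.
Qed.

Lemma homotopic_rel_ext f g : homotopic_rel t0 f g ->
  exists K : R * 'rV[R]_n -> T, [/\ continuous K,
    forall v, K (0, v) = cube_ext f v, forall v, K (1, v) = cube_ext g v &
    forall t v, ~ inside v -> K (t, v) = t0].
Proof.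
move=> [H [cH Hf Hg H0]].
exists (H \o (fun p => (clamp01 p.1, clamp_row p.2))); split.
- apply: within_comp_continuous cH _ _ => [|p]; last first.
    by split; [exact: clamp01_itv|exact: clamp_row_cube].
  apply: pair_continuous; first exact: clampf_continuous (@fst_continuous _ _).
  exact: comp_continuous (@snd_continuous _ _) clamp_row_continuous.
- move=> v /=; rewrite clamp01_le0// Hf//; exact: clamp_row_cube.
- move=> v /=; rewrite clamp01_ge1// Hg//; exact: clamp_row_cube.
- move=> t v /cube_bd_clamp_row vbd /=; apply: H0 => //; exact: clamp01_itv.
Qed.

End Target.

(** A bump function of the sup-distance to the centre: 0 from distance 1/2 on, and 1 up to distance
    3/8. The cube [[1/8, 7/8]^n] on which it is 1 exceeds [[1/4, 3/4]^n], which leaves room for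
    boxes to slide. *)
Definition plateau v : R := clamp01 (4 - 8 * `|\row_i (v ord0 i - 1 / 2)|).

Lemma plateau_continuous : continuous plateau.
Proof.
apply: clampf_continuous; apply: addf_continuous => [v|].
  exact: cst_continuous.
apply: oppf_continuous; apply: mulf_continuous => [v|]; first exact: cst_continuous.
apply: comp_continuous (@norm_continuous _ _).
by apply: row_continuous => i; apply: addf_continuous => v;
  [exact: coord_continuous|exact: cst_continuous].
Qed.

Lemma plateau_itv v : 0 <= plateau v <= 1.
Proof. exact: clamp01_itv. Qed.

Lemma plateau0 v : ~ inside v -> plateau v = 0.
Proof.
move=> /outsideP [i vi]; apply: clamp01_le0.
have : `|(\row_i (v ord0 i - 1 / 2)) ord0 i| <= `|\row_i (v ord0 i - 1 / 2)|.
  rewrite [leRHS]mx_normrE.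
  exact: (le_bigmax _ (fun ij => `|(\row_i (v ord0 i - 1 / 2)) ij.1 ij.2|) (ord0, i)).
rewrite !mxE; case: vi => vi; [rewrite ler0_norm|rewrite ger0_norm]; lra.
Qed.

Lemma plateau1 v : (forall i, 1 / 8 <= v ord0 i <= 7 / 8) -> plateau v = 1.
Proof.
move=> v1; apply: clamp01_ge1.
suff : `|\row_i (v ord0 i - 1 / 2)| <= 3 / 8 by lra.
rewrite [leLHS]mx_normrE; apply: bigmax_le => [|[i j] _]; first by lra.
rewrite !mxE (ord1 i) /= ler_norml; have := v1 j; lra.
Qed.

End CubeMaps.

(** * Concatenation as a wedge sum *)

Section Concat.
Context {R : realType} {n : nat} (i0 : 'I_n) (i00 : (i0 : nat) = 0%N).
Implicit Types v w : 'rV[R]_n.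

Definition left_half v : 'rV[R]_n :=
  \row_i (if (i : nat) == 0%N then 2 * v ord0 i else v ord0 i).

Definition right_half v : 'rV[R]_n :=
  \row_i (if (i : nat) == 0%N then 2 * v ord0 i - 1 else v ord0 i).

Lemma left_half_continuous : continuous left_half.
Proof.
apply: row_continuous => i; case: (_ == _); last exact: coord_continuous.
apply: mulf_continuous => [v|]; [exact: cst_continuous|exact: coord_continuous].
Qed.

Lemma right_half_continuous : continuous right_half.
Proof.
apply: row_continuous => i; case: (_ == _); last exact: coord_continuous.
apply: addf_continuous => [|v]; last exact: cst_continuous.
apply: mulf_continuous => [v|]; [exact: cst_continuous|exact: coord_continuous].
Qed.

Lemma inside_left_half v : inside (left_half v) -> inside v.
Proof. by move=> vi i; have := vi i; rewrite mxE; case: ifP => // _; lra. Qed.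

Lemma inside_right_half v : inside (right_half v) -> inside v.
Proof. by move=> vi i; have := vi i; rewrite mxE; case: ifP => // _; lra. Qed.

Lemma inside_left_half_lt v : inside (left_half v) -> v ord0 i0 < 1 / 2.
Proof. by move=> /(_ i0); rewrite mxE i00 eqxx; lra. Qed.

Lemma inside_right_half_gt v : inside (right_half v) -> 1 / 2 < v ord0 i0.
Proof. by move=> /(_ i0); rewrite mxE i00 eqxx; lra. Qed.

Lemma cube_concatE (T : Type) (f g : 'rV[R]_n -> T) v :
  cube_concat f g v =
  if v ord0 i0 <= 1 / 2 then f (left_half v) else g (right_half v).
Proof.
rewrite /cube_concat; case: asboolP => [/(_ i0 i00) ->//|vi].
case: ifP => // vi0; exfalso; apply: vi => i ii.
by rewrite (_ : i = i0)//; apply: ord_inj; rewrite ii i00.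
Qed.

Context (T : topologicalType) (t0 : T) (hT : hausdorff_space T).
Implicit Types f g : 'rV[R]_n -> T.

(** Each extended map is at [t0] on the half belonging to the other one. In this form concatenation
    is continuous by [wedge_sum_continuous]. *)
Lemma cube_ext_concat f g w : based_cube_map t0 f -> based_cube_map t0 g ->
  cube_ext (cube_concat f g) w =
  wedge_sum t0 (cube_ext f (left_half w)) (cube_ext g (right_half w)).
Proof.
move=> f0 g0; rewrite {1}/cube_ext /= cube_concatE mxE.
have [w1|w1] := leP (w ord0 i0) (1 / 2).
  have -> : clamp01 (w ord0 i0) <= 1 / 2.
    have [w0|w0] := leP (w ord0 i0) 0; first by rewrite clamp01_le0//; lra.
    by rewrite clamp01_id; lra.
  rewrite [cube_ext g _](cube_ext_outside g0) ?wedge_sumr; last first.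
    by move=> /inside_right_half_gt; lra.
  rewrite /cube_ext /=; congr f; apply/rowP => i; rewrite !mxE; case: ifP => // /eqP ii.
  have -> : i = i0 by apply: ord_inj; rewrite ii i00.
  have [w0|w0] := leP (w ord0 i0) 0; first by rewrite !clamp01_le0//; lra.
  by rewrite !clamp01_id; lra.
have -> : clamp01 (w ord0 i0) <= 1 / 2 = false.
  apply/negbTE; rewrite -ltNge; have [w2|w2] := leP 1 (w ord0 i0).
    by rewrite clamp01_ge1//; lra.
  by rewrite clamp01_id; lra.
rewrite [cube_ext f _](cube_ext_outside f0) ?wedge_suml; last first.
  by move=> /inside_left_half_lt; lra.
rewrite /cube_ext /=; congr g; apply/rowP => i; rewrite !mxE; case: ifP => // /eqP ii.
have -> : i = i0 by apply: ord_inj; rewrite ii i00.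
have [w2|w2] := leP 1 (w ord0 i0); first by rewrite !clamp01_ge1//; lra.
by rewrite !clamp01_id; lra.
Qed.

Lemma based_cube_concat f g : based_cube_map t0 f -> based_cube_map t0 g ->
  based_cube_map t0 (cube_concat f g).
Proof.
move=> f0 g0; apply: (@based_cube_map_global _ _ _ _ _ (fun w =>
  wedge_sum t0 (cube_ext f (left_half w)) (cube_ext g (right_half w)))).
- apply: wedge_sum_continuous => //.
  + move=> v; have [v0|v0] := leP (v ord0 i0) (1 / 2).
      by right; apply: cube_ext_outside g0 _ => /inside_right_half_gt; lra.
    by left; apply: cube_ext_outside f0 _ => /inside_left_half_lt; lra.
  + exact: comp_continuous left_half_continuous (cube_ext_continuous f0).
  + exact: comp_continuous right_half_continuous (cube_ext_continuous g0).
- by move=> v vc; rewrite -(cube_ext_id (cube_concat f g))// cube_ext_concat.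
- move=> v vi; rewrite (cube_ext_outside f0) ?wedge_suml.
    by apply: cube_ext_outside g0 _ => /inside_right_half.
  by move=> /inside_left_half.
Qed.

End Concat.

(** * The section *)

Section Splitting.
Context {R : realType} (X : topologicalType) (y0 : X) (x : nat -> X)
  (A : nat -> topologicalType) (a : forall j, A j)
  (hX : hausdorff_space X) (hA : forall j, hausdorff_space (A j)).
Context (gam : R -> X) (lo hi : nat -> R) (cgam : continuous gam)
  (gam0 : gam 0 = y0)
  (lohi : forall j, [/\ 1 / 4 <= lo j, lo j < hi j & hi j <= 3 / 4])
  (dis : forall i j, i <> j -> hi i <= lo j \/ hi j <= lo i)
  (gamx : forall j t, lo j <= t <= hi j -> gam t = x j).

(** Here [g] is the value of the map into [X], [u] the position along the path and [k] its damping: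
    0 holds the path at [y0], 1 lets it run. *)
Definition assemble (g : X) (k u : R) (c : forall j, A j) : Adj x a :=
  adj_glue x a (wedge_sum y0 g (gam (k * u))) c.

(** The path waits at [y0] where [g] is off it, and rests undamped at [x j] where [c j] is off
    [a j]. The strict bounds on [u] leave room for only one such [j]. *)
Definition assemble_ok (g : X) (k u : R) (c : forall j, A j) : Prop :=
  (g <> y0 -> k = 0) /\
  forall j, c j <> a j -> [/\ g = y0, k = 1, lo j < u & u < hi j].

Lemma assemble_compat g k u c : assemble_ok g k u c ->
  adj_compat x a (wedge_sum y0 g (gam (k * u))) c.
Proof.
move=> [gk cP]; split=> [j /cP [-> -> u1 u2]|i j /cP [_ _ i1 i2] /cP [_ _ j1 j2]].
  by rewrite wedge_suml mul1r; apply: gamx; lra.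
by apply: contrapT => /dis [?|?]; lra.
Qed.

Lemma assemble_continuous (T : topologicalType) (G : T -> X) (K U : T -> R)
    (C : T -> forall j, A j) :
  continuous G -> continuous K -> continuous U ->
  (forall j, continuous (fun t => C t j)) ->
  (forall t, assemble_ok (G t) (K t) (U t) (C t)) ->
  continuous (fun t => assemble (G t) (K t) (U t) (C t)).
Proof.
move=> cG cK cU cC ok; apply: adj_glue_continuous => //; last first.
  by move=> t; exact: assemble_compat.
apply: wedge_sum_continuous => //.
  move=> t; have [|Gt] := pselect (G t = y0); [by left|right].
  by rewrite (proj1 (ok t) Gt) mul0r.
by apply: comp_continuous cgam; exact: mulf_continuous.
Qed.

Lemma assemble_base u c : (forall j, c j = a j) ->
  assemble y0 0 u c = adj_base x a y0.
Proof. by move=> ca; rewrite /assemble mul0r gam0 wedge_suml adj_glue_base. Qed.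

Context {n : nat} (i0 i1 : 'I_n) (i00 : (i0 : nat) = 0%N) (i11 : (i1 : nat) = 1%N).
Implicit Types v w : 'rV[R]_n.

Definition lower_half v : 'rV[R]_n :=
  \row_i (if (i : nat) == 1%N then 2 * v ord0 i else v ord0 i).

Definition upper_half v : 'rV[R]_n :=
  \row_i (if (i : nat) == 1%N then 2 * v ord0 i - 1 else v ord0 i).

(** The affine chart onto the unit cube of the box with [v_1] in [[lo j, hi j]] and the other
    coordinates in [[1/4, 3/4]]. *)
Definition box j v : 'rV[R]_n :=
  \row_i (if (i : nat) == 1%N then (v ord0 i - lo j) / (hi j - lo j)
          else 2 * v ord0 i - 1 / 2).

Lemma lower_half_continuous : continuous lower_half.
Proof.
apply: row_continuous => i; case: (_ == _); last exact: coord_continuous.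
apply: mulf_continuous => [v|]; [exact: cst_continuous|exact: coord_continuous].
Qed.

Lemma upper_half_continuous : continuous upper_half.
Proof.
apply: row_continuous => i; case: (_ == _); last exact: coord_continuous.
apply: addf_continuous => [|v]; last exact: cst_continuous.
apply: mulf_continuous => [v|]; [exact: cst_continuous|exact: coord_continuous].
Qed.

Lemma box_continuous j : continuous (box j).
Proof.
apply: row_continuous => i; case: (_ == _).
  apply: mulf_continuous => [|v]; last exact: cst_continuous.
  by apply: addf_continuous => v; [exact: coord_continuous|exact: cst_continuous].
apply: addf_continuous => [|v]; last exact: cst_continuous.
apply: mulf_continuous => [v|]; [exact: cst_continuous|exact: coord_continuous].
Qed.

Lemma slot_itv j (t : R) :
  0 < (t - lo j) / (hi j - lo j) < 1 -> lo j < t < hi j.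
Proof.
have [_ lh _] := lohi j; have lh0 : 0 < hi j - lo j by rewrite subr_gt0.
by rewrite ltr_pdivlMr// mul0r ltr_pdivrMr// mul1r; lra.
Qed.

Lemma inside_lower_half v : inside (lower_half v) -> inside v.
Proof. by move=> vi i; have := vi i; rewrite mxE; case: ifP => // _; lra. Qed.

Lemma inside_upper_half v : inside (upper_half v) -> inside v.
Proof. by move=> vi i; have := vi i; rewrite mxE; case: ifP => // _; lra. Qed.

Lemma inside_lower_upper v : inside (lower_half v) -> ~ inside (upper_half v).
Proof. by move=> /(_ i1) + /(_ i1); rewrite !mxE i11 eqxx; lra. Qed.

Lemma inside_box j v : inside (box j v) ->
  lo j < v ord0 i1 < hi j /\ forall i, 1 / 4 <= v ord0 i <= 3 / 4.
Proof.
have [? ? ?] := lohi j; move=> vi; split.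
  by have := vi i1; rewrite mxE i11 eqxx => /slot_itv.
move=> i; have := vi i; rewrite mxE; case: ifP => _; last by lra.
by move=> /slot_itv; lra.
Qed.

Lemma inside_box_inside j v : inside (box j v) -> inside v.
Proof. by move=> /inside_box [_ vi] i; have := vi i; lra. Qed.

(** Inside the lower half the plateau of the upper half vanishes; on the boxes, which lie in
    [[1/4, 3/4]^n], it is 1. *)
Lemma splitting_ok v (g : X) (c : forall j, A j) :
  (g <> y0 -> inside (lower_half v)) ->
  (forall j, c j <> a j -> inside (box j (upper_half v))) ->
  assemble_ok g (plateau (upper_half v)) (upper_half v ord0 i1) c.
Proof.
move=> gP cP; split=> [/gP /inside_lower_upper /plateau0 //|j /cP vj].
have [/andP[v1 v2] vi] := inside_box vj; split=> //.
- apply: contrapT => /gP /inside_lower_upper; apply.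
  exact: inside_box_inside vj.
- by apply: plateau1 => i; have := vi i; lra.
Qed.

Definition splitting (g0 : 'rV[R]_n -> X) (g : forall j, 'rV[R]_n -> A j) v :
    Adj x a :=
  assemble (cube_ext g0 (lower_half v)) (plateau (upper_half v))
    (upper_half v ord0 i1) (fun j => cube_ext (g j) (box j (upper_half v))).

Lemma splitting_compat g0 g v : based_cube_map y0 g0 ->
  (forall j, based_cube_map (a j) (g j)) ->
  assemble_ok (cube_ext g0 (lower_half v)) (plateau (upper_half v))
    (upper_half v ord0 i1) (fun j => cube_ext (g j) (box j (upper_half v))).
Proof.
move=> g0b gb; apply: splitting_ok => [|j]; first exact: cube_ext_neq.
exact: cube_ext_neq (gb j).
Qed.

Lemma based_splitting g0 g : based_cube_map y0 g0 ->
  (forall j, based_cube_map (a j) (g j)) ->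
  based_cube_map (adj_base x a y0) (splitting g0 g).
Proof.
move=> g0b gb; apply: (@based_cube_map_global _ _ _ _ _ (splitting g0 g)) => //.
- apply: assemble_continuous.
  + exact: comp_continuous lower_half_continuous (cube_ext_continuous g0b).
  + exact: comp_continuous upper_half_continuous plateau_continuous.
  + exact: coordf_continuous upper_half_continuous.
  + move=> j; apply: comp_continuous (cube_ext_continuous (gb j)).
    exact: comp_continuous upper_half_continuous (@box_continuous j).
  + by move=> v; exact: splitting_compat.
- move=> v vi; rewrite /splitting plateau0; last by move=> /inside_upper_half.
  rewrite (cube_ext_outside g0b); last by move=> /inside_lower_half.
  rewrite assemble_base// => j; apply: cube_ext_outside (gb j) _.
  by move=> /inside_box_inside /inside_upper_half.
Qed.

(** The section is a pointwise formula in the given maps, so it can be applied to the homotopies at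
    each time. *)
Lemma splitting_homotopic g0 g h0 h :
  homotopic_rel y0 g0 h0 -> (forall j, homotopic_rel (a j) (g j) (h j)) ->
  homotopic_rel (adj_base x a y0) (splitting g0 g) (splitting h0 h).
Proof.
move=> /homotopic_rel_ext [K0 [cK0 K00 K01 K0b]] gh.
pose K j := projT1 (cid (homotopic_rel_ext (gh j))).
have KP j := projT2 (cid (homotopic_rel_ext (gh j))).
have cK j : continuous (K j) by case: (KP j).
have Kb j t v : ~ inside v -> K j (t, v) = a j by case: (KP j) => _ _ _; apply.
apply: (@homotopic_rel_global _ _ _ _ _ _ (fun p =>
  assemble (K0 (p.1, lower_half p.2)) (plateau (upper_half p.2))
    (upper_half p.2 ord0 i1) (fun j => K j (p.1, box j (upper_half p.2))))).
- have cu : continuous (fun p : R * 'rV[R]_n => upper_half p.2).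
    exact: comp_continuous (@snd_continuous _ _) upper_half_continuous.
  apply: assemble_continuous.
  + apply: comp_continuous cK0; apply: pair_continuous (@fst_continuous _ _) _.
    exact: comp_continuous (@snd_continuous _ _) lower_half_continuous.
  + exact: comp_continuous cu plateau_continuous.
  + exact: coordf_continuous cu.
  + move=> j; apply: comp_continuous (cK j).
    apply: pair_continuous (@fst_continuous _ _) _.
    exact: comp_continuous cu (@box_continuous j).
  + move=> p; apply: splitting_ok => [|j] Kp; apply: contrapT.
      by move=> /(K0b p.1).
    by move=> /(Kb j p.1).
- move=> v _ /=; rewrite K00; congr assemble.
  by apply: functional_extensionality_dep => j; case: (KP j) => _ + _ _; apply.
- move=> v _ /=; rewrite K01; congr assemble.
  by apply: functional_extensionality_dep => j; case: (KP j) => _ _ + _; apply.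
- move=> t v vi /=; rewrite plateau0; last by move=> /inside_upper_half.
  rewrite K0b; last by move=> /inside_lower_half.
  rewrite assemble_base// => j; apply: Kb.
  by move=> /inside_box_inside /inside_upper_half.
Qed.

(** Up to time 1/2 the path is drawn back along itself to [y0]; after that the lower half is
    stretched over the whole cube. *)
Lemma adj_r_splitting g0 g : based_cube_map y0 g0 ->
  (forall j, based_cube_map (a j) (g j)) ->
  homotopic_rel y0 (adj_r x a \o splitting g0 g) g0.
Proof.
move=> g0b gb.
pose stretch (p : R * 'rV[R]_n) : 'rV[R]_n := \row_i
  (if (i : nat) == 1%N then (2 - clamp01 (2 * p.1 - 1)) * p.2 ord0 i
   else p.2 ord0 i).
have cc i : continuous (fun p : R * 'rV[R]_n => p.2 ord0 i).
  exact: coordf_continuous (@snd_continuous _ _).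
have cs : continuous (fun p : R * 'rV[R]_n => p.1) by exact: fst_continuous.
have cst' (r : R) : continuous (fun _ : R * 'rV[R]_n => r).
  by move=> p; exact: cst_continuous.
have cu : continuous (fun p : R * 'rV[R]_n => upper_half p.2).
  exact: comp_continuous (@snd_continuous _ _) upper_half_continuous.
have sv t v : inside (stretch (t, v)) -> inside v.
  move=> vi i; have := vi i; rewrite mxE /=; case: ifP => // _.
  have := clamp01_itv (2 * t - 1); set s := clamp01 _; nra.
apply: (@homotopic_rel_global _ _ _ _ _ _ (fun p =>
  wedge_sum y0 (cube_ext g0 (stretch p))
    (gam (clamp01 (1 - 2 * p.1) * plateau (upper_half p.2) * upper_half p.2 ord0 i1)))).
- apply: wedge_sum_continuous => //.
  (* From time 1/2 on the path is at [y0]. Before that [stretch] is still [lower_half], and the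
     plateau vanishes where [g0] is off [y0]. *)
  + move=> p; have [p1|p1] := leP (1 / 2) p.1.
      by right; rewrite (@clamp01_le0 _ (1 - _)) ?mul0r//; lra.
    have [|/(cube_ext_neq g0b) pi] := pselect (cube_ext g0 (stretch p) = y0).
      by left.
    right; rewrite plateau0 ?mulr0 ?mul0r//; apply: inside_lower_upper => i.
    have := pi i; rewrite !mxE clamp01_le0; last by lra.
    by rewrite subr0.
  + apply: comp_continuous (cube_ext_continuous g0b).
    apply: row_continuous => i; case: (_ == _) => //.
    solve_continuous.
  + apply: comp_continuous cgam; apply: mulf_continuous; last exact: coordf_continuous.
    apply: mulf_continuous; first by solve_continuous.
    exact: comp_continuous cu plateau_continuous.
- move=> v _; rewrite /= adj_r_glue; last exact/assemble_compat/splitting_compat.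
  rewrite (@clamp01_ge1 _ (1 - _)); last by lra.
  rewrite mul1r; congr (wedge_sum _ (cube_ext _ _) _); apply/rowP => i; rewrite !mxE /=.
  by rewrite clamp01_le0 ?subr0//; lra.
- move=> v vc /=; rewrite (@clamp01_le0 _ (1 - _)); last by lra.
  rewrite !mul0r gam0 wedge_sumr -[RHS](cube_ext_id g0)//; congr cube_ext.
  apply/rowP => i; rewrite !mxE /= clamp01_ge1; last by lra.
  by case: ifP => // _; lra.
- move=> t v vi /=; rewrite plateau0; last by move=> /inside_upper_half.
  rewrite mulr0 mul0r gam0 wedge_sumr; apply: cube_ext_outside g0b _.
  by move=> /sv.
Qed.

(** Only the box of [j] survives under [r_j], and its chart is joined to the identity by a
    straight-line homotopy. *)
Lemma adj_rj_splitting g0 g j : based_cube_map y0 g0 ->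
  (forall j, based_cube_map (a j) (g j)) ->
  homotopic_rel (a j) (adj_rj x a j \o splitting g0 g) (g j).
Proof.
move=> g0b gb.
pose spread (p : R * 'rV[R]_n) : 'rV[R]_n := \row_i
  ((1 - clamp01 p.1) * box j (upper_half p.2) ord0 i
   + clamp01 p.1 * p.2 ord0 i).
have [lo4 lh hi4] := lohi j.
have lh0 : 0 < hi j - lo j by rewrite subr_gt0.
apply: (@homotopic_rel_global _ _ _ _ _ _ (fun p => cube_ext (g j) (spread p))).
- apply: comp_continuous (cube_ext_continuous (gb j)).
  have cc i : continuous (fun p : R * 'rV[R]_n => p.2 ord0 i).
    exact: coordf_continuous (@snd_continuous _ _).
  have cs : continuous (fun p : R * 'rV[R]_n => p.1) by exact: fst_continuous.
  have cb : continuous (fun p : R * 'rV[R]_n => box j (upper_half p.2)).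
    apply: comp_continuous (@box_continuous j).
    exact: comp_continuous (@snd_continuous _ _) upper_half_continuous.
  by solve_continuous.
- move=> v _; rewrite /= adj_rj_glue; last exact/assemble_compat/splitting_compat.
  congr cube_ext; apply/rowP => i; rewrite !mxE /= clamp01_le0//.
  by rewrite subr0 mul1r mul0r addr0.
- move=> v vc /=; rewrite -[RHS](cube_ext_id (g j))//; congr cube_ext.
  apply/rowP => i; rewrite !mxE /= clamp01_ge1//.
  by rewrite subrr mul0r mul1r add0r.
- move=> t v /outsideP [i vi] /=; apply: cube_ext_outside (gb j) _ => /(_ i).
  rewrite mxE /=; have := clamp01_itv t; set s := clamp01 t => s01.
  pose q := box j (upper_half v) ord0 i.
  (* The chart pushes outer coordinates further out on the same side, so convex combinations stay
     outside too. *)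
  have q01 : q <= 0 /\ v ord0 i <= 0 \/ 1 <= q /\ 1 <= v ord0 i.
    rewrite /q !mxE; case: vi => vi; [left|right]; split=> //.
      by case: (_ == _); rewrite ?ler_pdivrMr// ?mul0r; lra.
    by case: (_ == _); rewrite ?ler_pdivlMr// ?mul1r; lra.
  by case: q01 => -[? ?]; rewrite -/q; nra.
Qed.

(** Chart of a box of width 1/4 along [v_0], which slides from [(1/4, 1/2)] to [(1/8, 3/8)] as [s]
    goes from 0 to 1; [right_box] slides from [(1/2, 3/4)] to [(5/8, 7/8)]. These are the halves of
    one box at the start and the boxes of the two halves of the cube at the end. *)
Definition left_box j (s : R) v : 'rV[R]_n :=
  \row_i (if (i : nat) == 0%N then 4 * v ord0 i - 1 + s / 2 else box j v ord0 i).

Definition right_box j (s : R) v : 'rV[R]_n :=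
  \row_i (if (i : nat) == 0%N then 4 * v ord0 i - 2 - s / 2 else box j v ord0 i).

Lemma left_box0 j v : left_box j 0 v = left_half (box j v).
Proof.
by apply/rowP => i; rewrite !mxE; case: (nat_of_ord i) => [|[|k]] //=; lra.
Qed.

Lemma right_box0 j v : right_box j 0 v = right_half (box j v).
Proof.
by apply/rowP => i; rewrite !mxE; case: (nat_of_ord i) => [|[|k]] //=; lra.
Qed.

Lemma left_box1 j v : left_box j 1 v = box j (left_half v).
Proof.
by apply/rowP => i; rewrite !mxE; case: (nat_of_ord i) => [|[|k]] //=; lra.
Qed.

Lemma right_box1 j v : right_box j 1 v = box j (right_half v).
Proof.
by apply/rowP => i; rewrite !mxE; case: (nat_of_ord i) => [|[|k]] //=; lra.
Qed.

Lemma left_half_lower v : left_half (lower_half v) = lower_half (left_half v).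
Proof.
by apply/rowP => i; rewrite !mxE; case: (nat_of_ord i) => [|[|k]].
Qed.

Lemma right_half_lower v : right_half (lower_half v) = lower_half (right_half v).
Proof.
by apply/rowP => i; rewrite !mxE; case: (nat_of_ord i) => [|[|k]].
Qed.

Lemma left_half_upper v : left_half (upper_half v) = upper_half (left_half v).
Proof.
by apply/rowP => i; rewrite !mxE; case: (nat_of_ord i) => [|[|k]].
Qed.

Lemma right_half_upper v : right_half (upper_half v) = upper_half (right_half v).
Proof.
by apply/rowP => i; rewrite !mxE; case: (nat_of_ord i) => [|[|k]].
Qed.

(* For [s <= 1/2] this is at least [plateau v], and for [1/2 <= s] at least its
   two-fold copy, so that it equals 1 on both sliding boxes at all times. *)
Definition plateau_slide (s : R) v : R :=
  Num.max (Num.min 1 (2 - 2 * s) * plateau v)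
    (Num.min 1 (2 * s) * Num.max (plateau (left_half v)) (plateau (right_half v))).

Lemma plateau_slide_outside s v : ~ inside v -> plateau_slide s v = 0.
Proof.
move=> vi; rewrite /plateau_slide !plateau0 ?maxxx ?mulr0 ?maxxx//.
  by move=> /inside_right_half.
by move=> /inside_left_half.
Qed.

Lemma plateau_slide_eq1 (s : R) v : 0 <= s <= 1 ->
  s <= 1 / 2 /\ plateau v = 1 \/
  1 / 2 <= s /\ (plateau (left_half v) = 1 \/ plateau (right_half v) = 1) ->
  plateau_slide s v = 1.
Proof.
move=> s01 sv; have pv := plateau_itv v.
have m01 : 0 <= Num.max (plateau (left_half v)) (plateau (right_half v)) <= 1.
  have /andP[l0 l1] := plateau_itv (left_half v).
  have /andP[_ r1] := plateau_itv (right_half v).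
  by rewrite le_max ge_max l0 l1 r1.
have k1 : 0 <= Num.min 1 (2 - 2 * s) <= 1.
  by rewrite le_min ge_min lexx ler01 /=; lra.
have k2 : 0 <= Num.min 1 (2 * s) <= 1.
  by rewrite le_min ge_min lexx ler01 /=; lra.
apply/le_anti/andP; split.
  by rewrite ge_max; apply/andP; split; nra.
rewrite le_max; apply/orP; case: sv => [[s1 ->]|[s1 lr]].
  by left; rewrite mulr1 le_min lexx /=; lra.
right; rewrite min_l ?mul1r; last by lra.
by rewrite le_max; case: lr => ->; rewrite lexx ?orbT.
Qed.

(** Until time 1/2 the box lies in [[1/8, 7/8]^n]; from then on its image under [left_half] does. So
    one of the plateaus is 1 on it at each time. *)
Lemma inside_left_box j (s : R) v : 0 <= s <= 1 -> inside (left_box j s v) ->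
  [/\ plateau_slide s v = 1, lo j < v ord0 i1 < hi j, inside v
    & v ord0 i0 < 1 / 2].
Proof.
move=> s01 vi.
have [? ? ?] := lohi j.
have v0 : 1 / 4 - s / 8 < v ord0 i0 < 1 / 2 - s / 8.
  by have := vi i0; rewrite mxE i00 /=; lra.
have v1 : lo j < v ord0 i1 < hi j.
  by have := vi i1; rewrite !mxE i11 /= => /slot_itv.
have vS i : i <> i0 -> 1 / 4 <= v ord0 i <= 3 / 4.
  move=> ii0; have := vi i; rewrite mxE ifN; last first.
    by apply/eqP => ii; apply: ii0; apply: ord_inj; rewrite ii i00.
  by rewrite mxE; case: ifP => _; [move=> /slot_itv|]; lra.
split=> //; last by lra.
- apply: plateau_slide_eq1 => //; have [s2|s2] := leP s (1 / 2); [left|right].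
    split=> //; apply: plateau1 => i; have [->|/eqP /vS] := eqVneq i i0; lra.
  split; first exact: ltW.
  left; apply: plateau1 => i; rewrite mxE.
  have [->|/eqP ii0] := eqVneq i i0; first by rewrite i00 /=; lra.
  rewrite ifN; first by have := vS i ii0; lra.
  by apply/eqP => ii; apply: ii0; apply: ord_inj; rewrite ii i00.
- by move=> i; have [->|/eqP /vS] := eqVneq i i0; lra.
Qed.

Lemma inside_right_box j (s : R) v : 0 <= s <= 1 -> inside (right_box j s v) ->
  [/\ plateau_slide s v = 1, lo j < v ord0 i1 < hi j, inside v
    & 1 / 2 < v ord0 i0].
Proof.
move=> s01 vi.
have [? ? ?] := lohi j.
have v0 : 1 / 2 + s / 8 < v ord0 i0 < 3 / 4 + s / 8.
  by have := vi i0; rewrite mxE i00 /=; lra.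
have v1 : lo j < v ord0 i1 < hi j.
  by have := vi i1; rewrite !mxE i11 /= => /slot_itv.
have vS i : i <> i0 -> 1 / 4 <= v ord0 i <= 3 / 4.
  move=> ii0; have := vi i; rewrite mxE ifN; last first.
    by apply/eqP => ii; apply: ii0; apply: ord_inj; rewrite ii i00.
  by rewrite mxE; case: ifP => _; [move=> /slot_itv|]; lra.
split=> //; last by lra.
- apply: plateau_slide_eq1 => //; have [s2|s2] := leP s (1 / 2); [left|right].
    split=> //; apply: plateau1 => i; have [->|/eqP /vS] := eqVneq i i0; lra.
  split; first exact: ltW.
  right; apply: plateau1 => i; rewrite mxE.
  have [->|/eqP ii0] := eqVneq i i0; first by rewrite i00 /=; lra.
  rewrite ifN; first by have := vS i ii0; lra.
  by apply/eqP => ii; apply: ii0; apply: ord_inj; rewrite ii i00.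
- by move=> i; have [->|/eqP /vS] := eqVneq i i0; lra.
Qed.

Lemma splitting_concat g0 g h0 h : based_cube_map y0 g0 ->
  (forall j, based_cube_map (a j) (g j)) ->
  based_cube_map y0 h0 -> (forall j, based_cube_map (a j) (h j)) ->
  homotopic_rel (adj_base x a y0)
    (splitting (cube_concat g0 h0) (fun j => cube_concat (g j) (h j)))
    (cube_concat (splitting g0 g) (splitting h0 h)).
Proof.
move=> g0b gb h0b hb.
have gh0b := based_cube_concat i00 hX g0b h0b.
pose C (s : R) (w : 'rV[R]_n) j := wedge_sum (a j)
  (cube_ext (g j) (left_box j s w)) (cube_ext (h j) (right_box j s w)).
have Cneq s w j : C s w j <> a j ->
    inside (left_box j s w) \/ inside (right_box j s w).
  rewrite /C /wedge_sum; case: asboolP => _; first by move/(cube_ext_neq (hb j)); right.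
  by move/(cube_ext_neq (gb j)); left.
(* Only the boxes and the plateau move: concatenation along [v_0] commutes with halving along [v_1],
   so the map into [X] is kept fixed. *)
apply: (@homotopic_rel_global _ _ _ _ _ _ (fun p =>
  assemble (cube_ext (cube_concat g0 h0) (lower_half p.2))
    (plateau_slide (clamp01 p.1) (upper_half p.2)) (upper_half p.2 ord0 i1)
    (C (clamp01 p.1) (upper_half p.2)))).
- have cs : continuous (fun p : R * 'rV[R]_n => p.1) by exact: fst_continuous.
  have cu : continuous (fun p : R * 'rV[R]_n => upper_half p.2).
    exact: comp_continuous (@snd_continuous _ _) upper_half_continuous.
  apply: assemble_continuous.
  + apply: comp_continuous (cube_ext_continuous gh0b).
    exact: comp_continuous (@snd_continuous _ _) lower_half_continuous.
  + have cl := comp_continuous cu left_half_continuous.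
    have cr := comp_continuous cu right_half_continuous.
    apply: maxf_continuous; apply: mulf_continuous.
    * by solve_continuous.
    * exact: comp_continuous cu plateau_continuous.
    * by solve_continuous.
    * by apply: maxf_continuous;
        [exact: comp_continuous cl plateau_continuous
        |exact: comp_continuous cr plateau_continuous].
  + exact: coordf_continuous.
  + move=> j; have cb := comp_continuous cu (@box_continuous j).
    apply: wedge_sum_continuous => //.
    (* The two boxes stay on opposite sides of [v_0 = 1/2] throughout. *)
    * move=> p; have s01 := clamp01_itv p.1.
      have [|/(cube_ext_neq (gb j)) /(inside_left_box s01) [_ _ _ w0]] :=
        pselect (cube_ext (g j) (left_box j (clamp01 p.1) (upper_half p.2)) = a j).
        by left.
      right; apply: cube_ext_outside (hb j) _ => /(inside_right_box s01) [_ _ _].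
      by lra.
    * apply: comp_continuous (cube_ext_continuous (gb j)).
      by apply: row_continuous => i; case: (_ == _); solve_continuous.
    * apply: comp_continuous (cube_ext_continuous (hb j)).
      by apply: row_continuous => i; case: (_ == _); solve_continuous.
  + move=> p; have s01 := clamp01_itv p.1; split=> [/(cube_ext_neq gh0b)|j].
      by move=> /inside_lower_upper /plateau_slide_outside ->.
    have aux (w := upper_half p.2) : plateau_slide (clamp01 p.1) w = 1 ->
        lo j < w ord0 i1 < hi j -> inside w ->
        [/\ cube_ext (cube_concat g0 h0) (lower_half p.2) = y0,
          plateau_slide (clamp01 p.1) w = 1, lo j < w ord0 i1 & w ord0 i1 < hi j].
      move=> ps /andP[? ?] wi; split=> //.
      by apply: cube_ext_outside gh0b _ => /inside_lower_upper.
    by move=> /Cneq [/(inside_left_box s01)|/(inside_right_box s01)] [? ? ? _];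
      exact: aux.
- move=> v _ /=; rewrite clamp01_le0//.
  have -> : plateau_slide 0 (upper_half v) = plateau (upper_half v).
    have le12 : 1 <= 2 :> R by lra.
    rewrite /plateau_slide mulr0 subr0 (min_l le12) (min_r ler01) mul0r mul1r.
    by rewrite max_l//; case/andP: (plateau_itv (upper_half v)).
  congr assemble; apply: functional_extensionality_dep => j.
  by rewrite (cube_ext_concat i00 _ (gb j) (hb j)) /C left_box0 right_box0.
- move=> v vc /=; rewrite clamp01_ge1// (cube_concatE i00).
  have uv : upper_half v ord0 i0 = v ord0 i0 by rewrite mxE i00.
  have lv : lower_half v ord0 i0 = v ord0 i0 by rewrite mxE i00.
  have -> : plateau_slide 1 (upper_half v) = Num.max
      (plateau (left_half (upper_half v))) (plateau (right_half (upper_half v))).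
    rewrite /plateau_slide mulr1 subrr min_r// min_l ?mul0r ?mul1r; last by lra.
    rewrite max_r// le_max; apply/orP; left.
    by case/andP: (plateau_itv (left_half (upper_half v))).
  (* On each side of [v_0 = 1/2] all terms of the other side are at their base points or 0, and what
     remains is the section applied to one half. *)
  rewrite (cube_ext_concat i00 _ g0b h0b); case: leP => v0; rewrite /splitting.
    rewrite (cube_ext_outside h0b) ?wedge_sumr; last first.
      by move=> /(inside_right_half_gt i00); lra.
    rewrite [plateau (right_half _)]plateau0; last first.
      by move=> /(inside_right_half_gt i00); lra.
    rewrite max_l; last by case/andP: (plateau_itv (left_half (upper_half v))).
    rewrite left_half_lower left_half_upper; congr assemble.
      by rewrite -left_half_upper [RHS]mxE i11.
    apply: functional_extensionality_dep => j; rewrite /C.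
    rewrite left_box1 left_half_upper (cube_ext_outside (hb j)) ?wedge_sumr//.
    by rewrite right_box1 => /inside_box_inside /(inside_right_half_gt i00); lra.
  rewrite (cube_ext_outside g0b) ?wedge_suml; last first.
    by move=> /(inside_left_half_lt i00); lra.
  rewrite [plateau (left_half _)]plateau0; last first.
    by move=> /(inside_left_half_lt i00); lra.
  rewrite max_r; last by case/andP: (plateau_itv (right_half (upper_half v))).
  rewrite right_half_lower right_half_upper; congr assemble.
    by rewrite -right_half_upper [RHS]mxE i11.
  apply: functional_extensionality_dep => j; rewrite /C.
  rewrite right_box1 right_half_upper (cube_ext_outside (gb j)) ?wedge_suml//.
  by rewrite left_box1 => /inside_box_inside /(inside_left_half_lt i00); lra.
- move=> t v vi /=; have s01 := clamp01_itv t.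
  rewrite plateau_slide_outside; last by move=> /inside_upper_half.
  rewrite (cube_ext_outside gh0b); last by move=> /inside_lower_half.
  rewrite assemble_base// => j; apply: contrapT => /Cneq.
  by case=> [/(inside_left_box s01)|/(inside_right_box s01)] [_ _ /inside_upper_half].
Qed.

End Splitting.

Unset Implicit Arguments.

Theorem theorem3p12 (R : realType) (X : pseudoMetricType R) (y0 : X)
  (x : nat -> X) (A : nat -> topologicalType) (a : forall j, A j) :
  peano_continuum X -> (forall j, hausdorff_space (A j)) ->
  forall n : nat, (2 <= n)%N ->
  (* a homomorphism  S : pi_n(X,y0) (+) prod_j pi_n(A_j,a_j) -> pi_n(Y,y0),
     given on representatives, with  Psi o S = id *)
  exists S : ('rV[R]_n -> X) -> (forall j, 'rV[R]_n -> A j) ->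
             ('rV[R]_n -> Adj x a),
  [/\ (* S sends representatives to representatives *)
      (forall g0 g, based_cube_map y0 g0 ->
         (forall j, based_cube_map (a j) (g j)) ->
         based_cube_map (adj_base x a y0) (S g0 g)),
      (* S is well defined on homotopy classes *)
      (forall g0 g h0 h, based_cube_map y0 g0 ->
         (forall j, based_cube_map (a j) (g j)) ->
         based_cube_map y0 h0 -> (forall j, based_cube_map (a j) (h j)) ->
         homotopic_rel y0 g0 h0 -> (forall j, homotopic_rel (a j) (g j) (h j)) ->
         homotopic_rel (adj_base x a y0) (S g0 g) (S h0 h)),
      (* S is a homomorphism *)
      (forall g0 g h0 h, based_cube_map y0 g0 ->
         (forall j, based_cube_map (a j) (g j)) ->
         based_cube_map y0 h0 -> (forall j, based_cube_map (a j) (h j)) ->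
         homotopic_rel (adj_base x a y0)
           (S (cube_concat g0 h0) (fun j => cube_concat (g j) (h j)))
           (cube_concat (S g0 g) (S h0 h))) &
      (* Psi o S = id, Psi([f]) = ([r o f], [r_1 o f], [r_2 o f], ...) *)
      (forall g0 g, based_cube_map y0 g0 ->
         (forall j, based_cube_map (a j) (g j)) ->
         homotopic_rel y0 (adj_r x a \o S g0 g) g0 /\
         forall j, homotopic_rel (a j) (adj_rj x a j \o S g0 g) (g j))].
Proof.
move=> pX hA n n2; have [hX _ _ _] := pX.
have [gam [lo [hi [cgam gam0 lohi dis gamx]]]] := peano_path y0 x pX.
(* Dimension at least 2 gives two coordinates: one for adding classes, the other for stacking the
   boxes along the path. *)
pose i0 : 'I_n := Ordinal (ltnW n2); pose i1 : 'I_n := Ordinal n2.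
have i00 : (i0 : nat) = 0%N by []. have i11 : (i1 : nat) = 1%N by [].
exists (splitting y0 x a gam lo hi i1); split.
- by move=> g0 g g0b gb; exact: based_splitting.
- by move=> g0 g h0 h _ _ _ _; exact: splitting_homotopic.
- by move=> g0 g h0 h g0b gb h0b hb; exact: (splitting_concat hX hA cgam gam0 lohi dis gamx i00 i11).
- move=> g0 g g0b gb; split; first exact: adj_r_splitting.
  by move=> j; exact: adj_rj_splitting.
Qed.
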